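(* For any bounded-degree regular expander graph $G$, $t_{\mathsf{cov}}^{\mathsf{CRW}}(G) = \Theta(n)$. Precisely: let $(G_i)_{i\ge1}$ be a sequence of regular graphs with uniformly bounded degrees which is an expander, and let $n_i=|V(G_i)|$. Then there exist constants $c,C>0$ such that $c\,n_i\le t_{\mathsf{cov}}^{\mathsf{CRW}}(G_i)\le C\,n_i$ for all sufficiently large $i$.
   Context: All graphs are finite, simple, undirected and connected. For $S\subseteq V$, $\Gamma(S)=\{u:\{u,s\}\in E\text{ for some }s\in S\}$. The vertex expansion of $G$ is $\Psi_G=\min_{S\subseteq V:\,0<|S|/|V|\le1/2}|\Gamma(S)\setminus S|/|S|$. A sequence of regular graphs $(G_i)_{i\ge1}$ is an expander if there is a constant $\psi>0$ with $\Psi_{G_i}\ge\psi$ for all $i$, and $|V(G_i)|\to\infty$. The choice random walk (CRW) on $G$ is the following process: at each step two neighbours of the current vertex are sampled independently and uniformly at random (with replacement), and a controller, who may use the whole history of the walk, picks one of the two as the next vertex. A strategy is a rule specifying these choices. $t_{\mathsf{cov}}^{\mathsf{CRW}}(G)$ is the expected time for the CRW to visit every vertex of $G$, minimized over all strategies of the controller and maximized over the start vertex. *)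

(* Defs.v *)
From HB Require Import structures.
From mathcomp Require Import all_boot all_order all_algebra.
From mathcomp Require Import all_classical all_reals all_analysis.

Set Implicit Arguments.
Unset Strict Implicit.
Unset Printing Implicit Defensive.

Import Order.TTheory GRing.Theory Num.Theory.

Local Open Scope ring_scope.

Record graph := Graph {
  vertex :> finType;
  edge : rel vertex;
  edge_sym : symmetric edge;
  edge_irr : irreflexive edge;
  edge_conn : forall x y : vertex, connect edge x y }.

Definition degree (G : graph) (x : G) : nat := #|[set y | edge x y]|.

Definition regular (G : graph) : Prop :=
  exists d : nat, forall x : G, degree x = d.

Definition nbrs (G : graph) (S : {set G}) : {set G} :=
  [set u | [exists s in S, edge u s]].

(* The minimum over an empty range is +oo; this only happens if |V| <= 1. *)
Definition vertex_expansion (R : realType) (G : graph) : \bar R :=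
  \big[Order.min/+oo%E]_(S : {set G} |
      (0 < #|S|%:R / #|G|%:R :> R) && (#|S|%:R / #|G|%:R <= 2^-1 :> R))
    (#|nbrs S :\: S|%:R / #|S|%:R)%:E.

Definition is_expander (R : realType) (G : nat -> graph) : Prop :=
  [/\ forall i, regular (G i),
      exists2 psi : R, 0 < psi & forall i, (psi%:E <= vertex_expansion R (G i))%E
    & ((fun i => #|G i|) @ \oo --> \oo)%classic].

Section ChoiceRandomWalk.
Variables (R : realType) (G : graph).

(* The past of the walk, oldest step first: the vertex occupied before each
   step, and the pair of vertices that was offered there. *)
Definition history := seq (G * (G * G)).

(* [sigma h x o] tells whether the controller, at x with past h, takes the
   first component of the offered pair o. *)
Definition strategy := history -> G -> G * G -> bool.

Definition next_vertex (sigma : strategy) (h : history) (x : G) (o : G * G) : G :=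
  if sigma h x o then o.1 else o.2.

(* Vertices visited when the successive offers are os; the size of the result
   is (size os).+1. *)
Fixpoint trajectory (sigma : strategy) (h : history) (x : G)
    (os : seq (G * G)) : seq G :=
  x :: if os is o :: os'
       then trajectory sigma (rcons h (x, o)) (next_vertex sigma h x o) os'
       else [::].

(* Law of a pair of independent uniform neighbours of x. *)
Definition offer_prob (x : G) (o : G * G) : R :=
  if edge x o.1 && edge x o.2 then (degree x)%:R^-1 * (degree x)%:R^-1 else 0.

Fixpoint offers_prob (sigma : strategy) (h : history) (x : G)
    (os : seq (G * G)) : R :=
  if os is o :: os'
  then offer_prob x o *
       offers_prob sigma (rcons h (x, o)) (next_vertex sigma h x o) os'
  else 1.

Definition covers (w : seq G) : bool := [forall v, v \in w].

(* Probability that the cover time equals t: the vertices at times 0..t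
   exhaust G, those at times 0..t-1 do not. *)
Definition cover_time_prob (sigma : strategy) (x : G) (t : nat) : R :=
  \sum_(os : t.-tuple (G * G) |
      covers (trajectory sigma [::] x os) &&
      ~~ covers (take t (trajectory sigma [::] x os)))
    offers_prob sigma [::] x os.

(* Expectation of the cover time, which takes its values in nat and +oo; the
   second term is the contribution of the event that G is never covered
   (+oo * 0 = 0). *)
Definition expected_cover_time (sigma : strategy) (x : G) : \bar R :=
  (\sum_(0 <= t <oo) (t%:R * cover_time_prob sigma x t)%:E +
   +oo * (1 - \sum_(0 <= t <oo) (cover_time_prob sigma x t)%:E))%E.

Definition crw_cover_time : \bar R :=
  \big[Order.max/-oo%E]_(x : G)
    ereal_inf (range (fun sigma : strategy => expected_cover_time sigma x)).

End ChoiceRandomWalk.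

(* Main.v *)
Require Import Defs.
From mathcomp Require Import all_boot all_order all_algebra.
From mathcomp Require Import all_classical all_reals all_analysis.
From mathcomp Require Import ring lra zify.

(** The lower bound holds for every strategy: a walk that has made [t] steps has
seen at most [t + 1] vertices ([crw_cover_time_ge]).

For the upper bound, write [n] for the number of vertices, and fix a set [U] of
[w] vertices that are still to be visited. The controller alternates stretches
of uncontrolled walking with short stretches of greedy control.

Greedy control gains a power of [n / w]. Let [f_0] be the indicator of [U] and
[f_(j+1) x] the mean of the larger of the values of [f_j] at the two vertices
offered at [x]; [f_r x] is the probability of being in [U] after [r] steps of
the best control. As long as the support of [f_j] fills at most a quarter of the
graph, expansion forces many vertices to have neighbours on both sides of each
level set, so that the sum of [f_(j+1)] is at least [1 + psi / D ^ 2] times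
that of [f_j] ([sum_boost_ge]). The degree being at most [D], this can go on for
[r] steps, [r] about the logarithm of [n / w] in base [D]; a uniform vertex then
reaches [U] in [r] steps with a probability [rate] of order at least
[(w / n) * growth ^ r] ([rate_ge]).

Waiting until the walk has mixed costs about [log n] steps. Doing this before
each attempt would be too slow while [w] is comparable with [n], so the mixing
is paid once for about [log n] attempts in a row, made by blocks that consist of
order [r + 1] lazy steps and [r] greedy ones. Control multiplies the squared
norm of the law of the walk by at most [4] per step, whereas the spectral gap
(Cheeger's inequality, [sqnorm_act_Lazy]) makes the lazy steps contract its
distance to the uniform law; a block has enough lazy steps for the law to be
close to uniform again whenever a greedy stretch begins. Hence each attempt
succeeds with probability of order [rate] ([reward_ge]). The same estimate shows
that a vertex hit at the end of one block is unlikely to be hit again at the end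
of a later one ([sum_return_le]), so most of the successes are new vertices
([plan_gain]). When [w] is smaller than a certain power of [n], the length
[r + 1] of an attempt is already comparable with [log n] and a single attempt
suffices ([regime]).

So a plan visits new vertices at a cost of at most [cost r], of order
[(r + 1) * (D / growth) ^ r], steps for each of them in the mean
([plan_exists]). At most [n / D ^ r] values of [w] have depth [r], and
[(r + 1) * growth ^- r] is summable: the total cost is linear ([potential_le]).

To pass from plans to one strategy, consider the optimal expected covering time
[value T] truncated at [T] steps. A maximum principle bounds it by the total
cost uniformly in [T] ([value_le_drift]). Being bounded and nondecreasing in
[T], it grows by at most [1/2] at some [T]; twice [value T] is then a
supersolution of the optimality equation, and the strategy that follows this
function covers the graph in an expected time at most its initial value
([crw_cover_time_le]). *)

Set Implicit Arguments.
Unset Strict Implicit.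
Unset Printing Implicit Defensive.

Import Order.TTheory GRing.Theory Num.Theory.

Local Open Scope ring_scope.

(** * Kernels, measures and squared norms on a finite set *)

Section Kernels.
Variables (R : realType) (V : finType).
Implicit Types (K : V -> V -> R) (phi mu : V -> R).

(** The two actions of a kernel: [act] averages an observable over the next
position, [push] transports the law of the position; [act_dual] says that they
are adjoint. *)
Definition act K phi : V -> R := fun x => \sum_y K x y * phi y.
Definition push K mu : V -> R := fun y => \sum_x mu x * K x y.

Lemma act_dual K mu phi :
  \sum_x mu x * act K phi x = \sum_y push K mu y * phi y.
Proof.
under eq_bigr do rewrite mulr_sumr.
rewrite exchange_big /=; apply: eq_bigr => y _.
by rewrite mulr_suml; apply: eq_bigr => x _; rewrite mulrA.
Qed.

Definition dirac_fun (x : V) : V -> R := fun y => (x == y)%:R.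

Lemma sum_dirac_mul x phi : \sum_y dirac_fun x y * phi y = phi x.
Proof.
rewrite (bigD1 x) //= /dirac_fun eqxx mul1r big1 ?addr0 // => y /negPf.
by rewrite eq_sym => ->; rewrite mul0r.
Qed.

Lemma sum_mul_dirac x phi : \sum_y phi y * dirac_fun x y = phi x.
Proof. by under eq_bigr do rewrite mulrC; exact: sum_dirac_mul. Qed.

Definition sqnorm phi := \sum_x phi x ^+ 2.

Lemma sqnorm_ge0 phi : 0 <= sqnorm phi.
Proof. by apply: sumr_ge0 => x _; exact: sqr_ge0. Qed.

Lemma sqr_le_sqnorm phi x : phi x ^+ 2 <= sqnorm phi.
Proof.
rewrite /sqnorm (bigD1 x) //= lerDl.
by apply: sumr_ge0 => y _; exact: sqr_ge0.
Qed.

Lemma sqnorm_dirac x : sqnorm (dirac_fun x) = 1.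
Proof.
rewrite /sqnorm (bigD1 x) //= /dirac_fun eqxx expr1n big1 ?addr0 // => y /negPf.
by rewrite eq_sym => ->; rewrite expr0n.
Qed.

(** Convexity of the square: the variance is nonnegative. *)
Lemma mean_sqr (I : finType) (p f : I -> R) :
    (forall i, 0 <= p i) -> \sum_i p i = 1 ->
  (\sum_i p i * f i) ^+ 2 <= \sum_i p i * f i ^+ 2.
Proof.
move=> p0 p1; set e := \sum_i p i * f i.
have : 0 <= \sum_i p i * (f i - e) ^+ 2.
  by apply: sumr_ge0 => i _; apply: mulr_ge0; rewrite ?p0 ?sqr_ge0.
rewrite (eq_bigr (fun i => p i * f i ^+ 2 + (- (2 * e) * (p i * f i)
   + e ^+ 2 * p i))); last by move=> i _; ring.
rewrite !big_split /= -!mulr_sumr -/e p1; lra.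
Qed.

End Kernels.

(** * One step of the walk under control *)

Section Moves.
Variables (R : realType) (G : graph) (d : nat).
Hypotheses (reg : forall x : G, degree x = d) (d_gt0 : (0 < d)%N).
Implicit Types (phi mu : G -> R) (x y : G).

Let dR_gt0 : 0 < d%:R :> R. Proof. by rewrite ltr0n. Qed.
Let dR_neq0 : d%:R != 0 :> R. Proof. by rewrite gt_eqF. Qed.

Definition srw x y : R := (edge x y)%:R / (degree x)%:R.

Lemma srw_ge0 x y : 0 <= srw x y.
Proof. by rewrite divr_ge0. Qed.

Lemma srw_sym x y : srw x y = srw y x.
Proof. by rewrite /srw !reg edge_sym. Qed.

Lemma sum_srw x : \sum_y srw x y = 1.
Proof.
rewrite /srw -mulr_suml -natr_sum reg.
suff -> : (\sum_(y : G) edge x y)%N = d by rewrite mulfV.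
rewrite -(reg x) /degree -sum1_card [RHS]big_mkcond /=.
by apply: eq_bigr => y _; rewrite inE; case: edge.
Qed.

Lemma sum_srwl y : \sum_x srw x y = 1.
Proof. by under eq_bigr do rewrite srw_sym; exact: sum_srw. Qed.

Lemma offer_probE x o : offer_prob R x o = srw x o.1 * srw x o.2.
Proof.
rewrite /offer_prob /srw.
by case: edge; case: edge; rewrite /= ?mul0r ?mulr0 // !mul1r.
Qed.

Lemma offer_prob_ge0 x o : 0 <= offer_prob R x o.
Proof. by rewrite offer_probE mulr_ge0 // srw_ge0. Qed.

Lemma sum_offer (F : G -> G -> R) x :
  \sum_o offer_prob R x o * F o.1 o.2
  = \sum_y srw x y * (\sum_z srw x z * F y z).
Proof.
under eq_bigr do rewrite offer_probE.
rewrite -(pair_bigA _ (fun y z => srw x y * srw x z * F y z)) /=.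
apply: eq_bigr => y _; rewrite mulr_sumr; apply: eq_bigr => z _.
by rewrite mulrA.
Qed.

Lemma sum_offer_prob x : \sum_o offer_prob R x o = 1.
Proof.
transitivity (\sum_o offer_prob R x o * (fun _ _ => 1) o.1 o.2).
  by apply: eq_bigr => o _; rewrite mulr1.
rewrite (sum_offer (fun _ _ => 1)) -[RHS](sum_srw x); apply: eq_bigr => y _.
by rewrite -mulr_suml sum_srw !mulr1.
Qed.

Lemma sum_offer1 x phi : \sum_o offer_prob R x o * phi o.1 = act srw phi x.
Proof.
rewrite (sum_offer (fun y _ => phi y)); apply: eq_bigr => y _.
by rewrite -mulr_suml sum_srw mul1r.
Qed.

Lemma sum_offer2 x phi : \sum_o offer_prob R x o * phi o.2 = act srw phi x.
Proof.
rewrite (sum_offer (fun _ y => phi y)) -mulr_suml sum_srw mul1r.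
by apply: eq_bigr.
Qed.

(** A step of a plan. A lazy step, which stays put with probability one half,
is not available to the walk itself: it stands for tossing a coin on whether to
make a uniform step now or to pass on to the rest of the plan, and it saves time
rather than spending it. It is what makes mixing possible on bipartite graphs.
[Ctrl s] is one step of the walk where [s] selects the offer. *)
Inductive move := Lazy | Ctrl of (G -> G * G -> bool).

Definition chosen (s : G -> G * G -> bool) x (o : G * G) :=
  if s x o then o.1 else o.2.

Definition kern (k : move) x y : R :=
  match k with
  | Lazy => 2^-1 * (dirac_fun R x y + srw x y)
  | Ctrl s => \sum_o offer_prob R x o * dirac_fun R (chosen s x o) y
  end.

Lemma act_Lazy phi x : act (kern Lazy) phi x = 2^-1 * (phi x + act srw phi x).
Proof.
rewrite /act /= -[X in _ * (X + _)](sum_dirac_mul x phi) -big_split /= mulr_sumr.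
by apply: eq_bigr => y _; rewrite -mulrA mulrDl.
Qed.

Lemma act_Ctrl s phi x :
  act (kern (Ctrl s)) phi x = \sum_o offer_prob R x o * phi (chosen s x o).
Proof.
rewrite /act /=; under eq_bigr do rewrite mulr_suml.
rewrite exchange_big /=; apply: eq_bigr => o _.
by under eq_bigr do rewrite -mulrA; rewrite -mulr_sumr sum_dirac_mul.
Qed.

Lemma kern_ge0 k x y : 0 <= kern k x y.
Proof.
case: k => [|s] /=; first by rewrite mulr_ge0 ?invr_ge0 ?addr_ge0 ?srw_ge0.
by apply: sumr_ge0 => o _; rewrite mulr_ge0 ?offer_prob_ge0.
Qed.

Lemma sum_kern k x : \sum_y kern k x y = 1.
Proof.
transitivity (act (kern k) (fun _ => 1) x).
  by apply: eq_bigr => y _; rewrite mulr1.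
case: k => [|s].
  rewrite act_Lazy /act; under eq_bigr do rewrite mulr1.
  by rewrite sum_srw; lra.
by rewrite act_Ctrl; under eq_bigr do rewrite mulr1; exact: sum_offer_prob.
Qed.

Lemma push_srw mu : push srw mu = act srw mu.
Proof.
by apply/funext => y; apply: eq_bigr => x _; rewrite mulrC srw_sym.
Qed.

Lemma push_Lazy mu : push (kern Lazy) mu = act (kern Lazy) mu.
Proof.
apply/funext => y; apply: eq_bigr => x _; rewrite mulrC /=.
by rewrite srw_sym /dirac_fun eq_sym.
Qed.

(** Whatever the selection rule, the chosen vertex is one of two uniform
neighbours, hence the factor two. *)
Lemma kern_Ctrl_le s x y : kern (Ctrl s) x y <= 2 * srw x y.
Proof.
have srw_dirac : act srw (dirac_fun R y) x = srw x y.
  exact: sum_mul_dirac.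
rewrite mulr_natl mulr2n -{1}srw_dirac -sum_offer1 -srw_dirac -sum_offer2.
rewrite -big_split; apply: ler_sum => o _ /=.
rewrite -mulrDr; apply: ler_wpM2l; first exact: offer_prob_ge0.
rewrite /chosen /dirac_fun ![y == _]eq_sym.
by case: ifP => _; rewrite ?lerDl ?lerDr.
Qed.

Lemma sqnorm_act_srw phi : sqnorm (act srw phi) <= sqnorm phi.
Proof.
apply: (@le_trans _ _ (\sum_x \sum_y srw x y * phi y ^+ 2)).
  apply: ler_sum => x _; apply: mean_sqr (sum_srw x) => y; exact: srw_ge0.
rewrite exchange_big /=; apply: ler_sum => y _.
by rewrite -mulr_suml sum_srwl mul1r.
Qed.

Lemma push_ge0 k mu : (forall x, 0 <= mu x) -> forall y, 0 <= push (kern k) mu y.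
Proof.
by move=> mu0 y; apply: sumr_ge0 => x _; rewrite mulr_ge0 ?mu0 ?kern_ge0.
Qed.

Lemma sum_push k mu : \sum_y push (kern k) mu y = \sum_x mu x.
Proof.
rewrite exchange_big /=; apply: eq_bigr => x _.
by rewrite -mulr_sumr sum_kern mulr1.
Qed.

(** Control can concentrate the law of the walk, but by no more than a bounded
factor per step; mixing has to pay for this factor. *)
Lemma sqnorm_push_Ctrl s mu : (forall x, 0 <= mu x) ->
  sqnorm (push (kern (Ctrl s)) mu) <= 4 * sqnorm mu.
Proof.
move=> mu0; apply: (@le_trans _ _ (4 * sqnorm (act srw mu))).
  rewrite mulr_sumr; apply: ler_sum => y _.
  have -> : 4 * act srw mu y ^+ 2 = (2 * act srw mu y) ^+ 2 :> R by ring.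
  rewrite -push_srw ler_sqr ?nnegrE ?push_ge0 //; last first.
    by rewrite mulr_ge0 // sumr_ge0 // => x _; rewrite mulr_ge0 ?mu0 ?srw_ge0.
  rewrite mulr_sumr; apply: ler_sum => x _.
  by rewrite mulrCA; apply: ler_wpM2l; rewrite ?mu0 ?kern_Ctrl_le.
by rewrite ler_pM2l // sqnorm_act_srw.
Qed.

Definition acts (ks : seq move) phi := foldr (fun k f => act (kern k) f) phi ks.
Definition pushes (ks : seq move) mu := foldl (fun m k => push (kern k) m) mu ks.

Lemma acts_dual ks mu phi :
  \sum_x mu x * acts ks phi x = \sum_y pushes ks mu y * phi y.
Proof. by elim: ks mu => //= k ks IH mu; rewrite act_dual IH. Qed.

Lemma acts_dirac ks phi x :
  acts ks phi x = \sum_y pushes ks (dirac_fun R x) y * phi y.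
Proof. by rewrite -acts_dual sum_dirac_mul. Qed.

Lemma acts_cat ks1 ks2 phi : acts (ks1 ++ ks2) phi = acts ks1 (acts ks2 phi).
Proof. by rewrite /acts foldr_cat. Qed.

Lemma pushes_cat ks1 ks2 mu : pushes (ks1 ++ ks2) mu = pushes ks2 (pushes ks1 mu).
Proof. by rewrite /pushes foldl_cat. Qed.

Lemma act_le k (phi psi : G -> R) : (forall y, phi y <= psi y) ->
  forall x, act (kern k) phi x <= act (kern k) psi x.
Proof.
by move=> le x; apply: ler_sum => y _; rewrite ler_wpM2l ?kern_ge0.
Qed.

Lemma acts_le ks (phi psi : G -> R) : (forall y, phi y <= psi y) ->
  forall x, acts ks phi x <= acts ks psi x.
Proof. by move=> le; elim: ks => //= k ks IH; exact: act_le. Qed.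

Lemma act_lin k a b (phi psi : G -> R) x :
  act (kern k) (fun y => a * phi y + b * psi y) x
  = a * act (kern k) phi x + b * act (kern k) psi x.
Proof.
rewrite /act !mulr_sumr -big_split; apply: eq_bigr => y _ /=; ring.
Qed.

Lemma act_const k a x : act (kern k) (fun=> a) x = a.
Proof. by rewrite /act -mulr_suml sum_kern mul1r. Qed.

Lemma acts_lin ks a b (phi psi : G -> R) x :
  acts ks (fun y => a * phi y + b * psi y) x = a * acts ks phi x + b * acts ks psi x.
Proof.
elim: ks x => //= k ks IH x; rewrite -act_lin.
by apply: eq_bigr => y _; rewrite IH.
Qed.

Lemma acts_const ks a x : acts ks (fun=> a) x = a.
Proof.
elim: ks x => //= k ks IH x; rewrite -[RHS](act_const k a x).
by apply: eq_bigr => y _; rewrite IH.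
Qed.

Lemma pushes_ge0 ks mu : (forall x, 0 <= mu x) -> forall y, 0 <= pushes ks mu y.
Proof. by elim: ks mu => //= k ks IH mu mu0; apply: IH; exact: push_ge0. Qed.

Lemma sum_pushes ks mu : \sum_y pushes ks mu y = \sum_x mu x.
Proof. by elim: ks mu => //= k ks IH mu; rewrite IH sum_push. Qed.

End Moves.

(** * Layers and medians of a function on a finite set *)

Section Layers.
Variables (R : realType) (V : finType).

(** Removing the smallest positive value of a function from its support
exhibits it as a multiple of an indicator plus a function supported in the same
set. Both functionals below, the total variation along edges and the mean of a
maximum, are additive for such a decomposition because it is comonotone, so
they need to be studied on indicators only. *)
Lemma layer_ind (Q : (V -> R) -> Prop) (N : nat) :
    Q (fun=> 0) ->
    (forall c (S : {set V}) phi, 0 <= c -> (0 < #|S| <= N)%N ->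
       (forall x, 0 <= phi x) -> (forall x, x \notin S -> phi x = 0) ->
       Q phi -> Q (fun x => c * (x \in S)%:R + phi x)) ->
  forall phi, (forall x, 0 <= phi x) -> (#|[set x | phi x != 0%R]| <= N)%N -> Q phi.
Proof.
move=> Q0 QS phi.
have [k] := ubnP #|[set x | phi x != 0%R]|; elim: k phi => // k IH phi lek phi0 leN.
set S := [set x | phi x != 0] in lek leN.
have [S0|[x0 x0S]] := set_0Vmem S.
  rewrite (_ : phi = fun=> 0) //; apply/funext => x; apply/eqP.
  have : x \notin S by rewrite S0 finset.in_set0.
  by rewrite inE negbK.
case: (arg_minP phi x0S) => z zS zmin.
have {}zS : z \in S by [].
pose psi x := if x \in S then phi x - phi z else 0.
have -> : phi = fun x => phi z * (x \in S)%:R + psi x.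
  apply/funext => x; rewrite /psi; case: ifPn => xS.
    by rewrite mulr1 addrC subrK.
  by rewrite mulr0 addr0; move: xS; rewrite inE negbK => /eqP.
have psi0 x : 0 <= psi x.
  by rewrite /psi; case: ifP => // xS; rewrite subr_ge0 zmin.
have psiS x : x \notin S -> psi x = 0 by rewrite /psi => /negPf ->.
have ltS : (#|[set x | psi x != 0%R]| < #|S|)%N.
  apply: proper_card; apply/properP; split.
    apply/fintype.subsetP => x; rewrite [in X in X -> _]inE.
    by apply: contraR => /psiS ->.
  have psiz : psi z = 0 by rewrite /psi zS subrr.
  by exists z => //; rewrite inE psiz eqxx.
apply: QS => //; first by rewrite leN andbT; apply/card_gt0P; exists z.
apply: IH => //; first exact: (leq_trans ltS).
exact: leq_trans (ltnW ltS) leN.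
Qed.

Lemma median (g : V -> R) (v0 : V) : exists c,
  (2 * #|[set x | (c < g x)%R]| <= #|V|)%N /\ (2 * #|[set x | (g x < c)%R]| <= #|V|)%N.
Proof.
pose A := [set x | (2 * #|[set y | (g x < g y)%R]| <= #|V|)%N].
have [m _ mmax] := arg_maxP g (isT : xpredT v0).
have {}mmax y : g y <= g m by exact: mmax.
have mA : m \in A.
  rewrite inE (_ : [set y | _] = finset.set0) ?cards0 ?muln0 //.
  by apply/finset.setP => y; rewrite !inE ltNge mmax.
have [z zA zmin] := arg_minP g mA.
have {}zA : z \in A by [].
exists (g z); split; first by move: zA; rewrite inE.
have [->|[y0 y0B]] := set_0Vmem [set x | (g x < g z)%R].
  by rewrite cards0 muln0.
have [y yB ymax] := arg_maxP g y0B.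
have {yB} ylt : (g y < g z)%R.
  by have : y \in [set x | (g x < g z)%R] by []; rewrite inE.
have {}ymax x : (g x < g z)%R -> g x <= g y 
  by move=> xz; apply: ymax; have : x \in [set x | (g x < g z)%R] by rewrite inE.
have : y \notin A by apply/negP => /zmin; rewrite leNgt ylt.
rewrite inE -ltnNge => lt.
suff : (#|[set x | (g x < g z)%R]| + #|[set x | (g y < g x)%R]| <= #|V|)%N by lia.
rewrite -cardsUI (_ : _ :&: _ = finset.set0) ?cards0 ?addn0 ?max_card //.
apply/finset.setP => x; rewrite !inE; apply/negP => /andP[xz].
by rewrite ltNge ymax.
Qed.

End Layers.

(** * What vertex expansion gives: a spectral gap and growth under control *)

Section Expansion.
Variables (R : realType) (G : graph) (d D : nat) (psi : R).
Hypotheses (reg : forall x : G, degree x = d) (d_gt0 : (0 < d)%N).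
Hypotheses (dD : (d <= D)%N) (psi_gt0 : 0 < psi).
Hypothesis expansion : forall S : {set G}, (0 < #|S|)%N ->
  (2 * #|S| <= #|G|)%N -> psi * #|S|%:R <= #|nbrs S :\: S|%:R.
Implicit Types (phi : G -> R) (x y : G) (S : {set G}).

Notation P := (@srw R G).

Let dR_gt0 : 0 < d%:R :> R. Proof. by rewrite ltr0n. Qed.
Let DR_gt0 : 0 < D%:R :> R. Proof. by rewrite ltr0n (leq_trans d_gt0). Qed.
Let leDd : D%:R^-1 <= d%:R^-1 :> R.
Proof. by rewrite lef_pV2 ?posrE // ler_nat. Qed.

Lemma srw_edge x y : edge x y -> P x y = d%:R^-1.
Proof. by rewrite /srw reg => ->; rewrite mul1r. Qed.

Lemma sum_in_card (A : {set G}) : \sum_x (x \in A)%:R = #|A|%:R :> R.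
Proof.
by rewrite -natr_sum -sum1_card [in RHS]big_mkcond.
Qed.

Lemma sum_act_srw phi : \sum_x act P phi x = \sum_x phi x.
Proof.
rewrite exchange_big /=; apply: eq_bigr => y _.
by rewrite -mulr_suml (sum_srwl _ reg) ?mul1r.
Qed.

Lemma sum_srw_term phi x y : (forall z, 0 <= phi z) -> P x y * phi y <= act P phi x.
Proof.
move=> phi0; rewrite /act (bigD1 y) //= lerDl; apply: sumr_ge0 => z _.
by rewrite mulr_ge0 ?srw_ge0.
Qed.

(** Expansion for functions: on an indicator the left-hand side counts, up to
normalization, the edges that leave the set. *)
Lemma variation_ge phi : (forall x, 0 <= phi x) ->
    (2 * #|[set x | phi x != 0%R]| <= #|G|)%N ->
  psi / D%:R * \sum_x phi x <= \sum_x \sum_y P x y * `|phi x - phi y|.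
Proof.
move=> phi0 le2; have {le2} le2 : (#|[set x | phi x != 0%R]| <= #|G| %/ 2)%N by lia.
move: phi phi0 le2; apply: layer_ind.
  rewrite big1 // mulr0; apply: sumr_ge0 => x _; apply: sumr_ge0 => y _.
  by rewrite mulr_ge0 ?srw_ge0.
move=> c S phi c0 /andP[S0 SN] phi0 phiS IH.
rewrite big_split /= -mulr_sumr sum_in_card.
have -> : \sum_x \sum_y P x y *
    `|c * (x \in S)%:R + phi x - (c * (y \in S)%:R + phi y)|
  = c * (\sum_x \sum_y P x y * `|(x \in S)%:R - (y \in S)%:R|)
    + \sum_x \sum_y P x y * `|phi x - phi y|.
  rewrite mulr_sumr -big_split; apply: eq_bigr => x _ /=.
  rewrite mulr_sumr -big_split; apply: eq_bigr => y _ /=.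
  rewrite mulrCA -mulrDr; congr (_ * _).
  case: (boolP (x \in S)) (phi0 x) (phiS x) => xS px0 px;
   case: (boolP (y \in S)) (phi0 y) (phiS y) => yS py0 py.
  - rewrite subrr normr0 mulr0 add0r; congr (`| _ |); ring.
  - rewrite py // subr0 normr1 !mulr1 mulr0 !addr0 !subr0 !ger0_norm //.
    by rewrite addr_ge0.
  - rewrite px // mulr0 mulr1 !add0r !normrN normr1 mulr1 !ger0_norm //.
    by rewrite addr_ge0.
  - by rewrite px // py // !mulr0 !subrr normr0 mulr0 add0r.
rewrite mulrDr lerD // mulrCA ler_wpM2l //.
apply: (@le_trans _ _ (d%:R^-1 * #|nbrs S :\: S|%:R)).
  apply: (@le_trans _ _ (D%:R^-1 * #|nbrs S :\: S|%:R)); last exact: ler_wpM2r.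
  rewrite mulrAC mulrC ler_wpM2l ?invr_ge0 ?ler0n // expansion //.
  by apply: (@leq_trans (2 * (#|G| %/ 2))%N); lia.
rewrite -sum_in_card mulr_sumr; apply: ler_sum => x _.
have sum_ge0 : 0 <= \sum_y P x y * `|(x \in S)%:R - (y \in S)%:R : R|.
  by apply: sumr_ge0 => y _; rewrite mulr_ge0 ?srw_ge0.
case: (boolP (x \in nbrs S :\: S)) => [|_]; last by rewrite mulr0.
rewrite !inE => /andP[xS /exists_inP[s sS xs]].
rewrite mulr1 (bigD1 s) //= srw_edge // sS (negPf xS) sub0r normrN normr1 mulr1.
by rewrite lerDl; apply: sumr_ge0 => y _; rewrite mulr_ge0 ?srw_ge0.
Qed.

Definition energy phi := \sum_x \sum_y P x y * (phi x - phi y) ^+ 2.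

Lemma sum_srw_l phi : \sum_x \sum_y P x y * phi x = \sum_x phi x.
Proof. by apply: eq_bigr => x _; rewrite -mulr_suml (sum_srw _ reg) ?mul1r. Qed.

Lemma sum_srw_r phi : \sum_x \sum_y P x y * phi y = \sum_x phi x.
Proof. exact: sum_act_srw. Qed.

(** Cheeger's argument: apply [variation_ge] to the square of [phi] and factor
the difference of squares. *)
Lemma energy_supp phi : (forall x, 0 <= phi x) ->
    (2 * #|[set x | phi x != 0%R]| <= #|G|)%N ->
  (psi / D%:R) ^+ 2 / 4 * sqnorm phi <= energy phi.
Proof.
move=> phi0 le2; set b := psi / D%:R; have b0 : 0 < b by rewrite divr_gt0.
have := @variation_ge (fun x => phi x ^+ 2) (fun x => sqr_ge0 _).
rewrite (_ : [set _ | _] = [set x | phi x != 0]); last first.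
  by apply/finset.setP => x; rewrite !inE sqrf_eq0.
move=> /(_ le2); rewrite -/b => var.
(* AM-GM with the weight that leaves half of the squared norm on the left. *)
have : \sum_x \sum_y P x y * `|phi x ^+ 2 - phi y ^+ 2| <=
   2 / b * energy phi + b / 4 * (sqnorm phi + sqnorm phi).
  rewrite -{1}[sqnorm phi]sum_srw_l -{1}[sqnorm phi]sum_srw_r /energy.
  rewrite -!big_split mulr_sumr mulr_sumr -big_split; apply: ler_sum => x _ /=.
  rewrite -!big_split mulr_sumr mulr_sumr -big_split; apply: ler_sum => y _ /=.
  rewrite -mulrDr !(mulrCA _ (P x y)) -mulrDr.
  apply: ler_wpM2l; first exact: srw_ge0.
  rewrite subr_sqr normrM [X in _ * X]ger0_norm ?addr_ge0 //.
  rewrite -[X in _ / b * X]real_normK ?num_real //.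
  set u := `|phi x - phi y|; set v := phi x + phi y.
  apply: (@le_trans _ _ (2 / b * u ^+ 2 + b / 8 * v ^+ 2)); last first.
    rewrite lerD2l (_ : b / 8 = b / 4 / 2); last by field.
    rewrite -mulrA; apply: ler_wpM2l; first by rewrite mulr_ge0 ?(ltW b0).
    rewrite /v.
    have := sqr_ge0 (phi x - phi y); nra.
  have : 0 <= 2 / b * (u - b / 4 * v) ^+ 2.
    by rewrite mulr_ge0 ?sqr_ge0 // divr_ge0 // ltW.
  have -> : 2 / b * (u - b / 4 * v) ^+ 2
     = 2 / b * u ^+ 2 + b / 8 * v ^+ 2 - u * v; last lra.
  by field; rewrite gt_eqF.
move=> /(le_trans var); rewrite -/(sqnorm phi) => le.
have {}le : b / 2 * sqnorm phi <= 2 / b * energy phi by lra.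
have : b / 2 * (b / 2 * sqnorm phi) <= b / 2 * (2 / b * energy phi).
  by apply: ler_wpM2l => //; rewrite divr_ge0 // ltW.
rewrite [X in _ <= X](_ : _ = energy phi); last by field; rewrite gt_eqF.
by apply: le_trans; rewrite le_eqVlt; apply/orP; left; apply/eqP; field.
Qed.

(** Cut [phi] at a median, so that its positive and negative parts both have
small support; cutting does not increase the energy, and shifting a function of
mean zero does not decrease its squared norm. *)
Lemma poincare phi : \sum_x phi x = 0 ->
  (psi / D%:R) ^+ 2 / 4 * sqnorm phi <= energy phi.
Proof.
move=> sum0; set b := _ / 4.
have [v0 _|G0] := pickP (xpredT : pred G); last first.
  rewrite /energy /sqnorm !big1 ?mulr0 // => x; by have := G0 x.
have [c [gtc ltc]] := median phi v0.
pose p x := Num.max (phi x - c) 0; pose q x := Num.max (c - phi x) 0.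
have lep : b * sqnorm p <= energy p.
  apply: energy_supp => [x|]; first by rewrite le_max lexx orbT.
  apply: leq_trans gtc; rewrite leq_mul2l /=; apply/subset_leq_card/fintype.subsetP => x.
  rewrite !inE /p; apply: contraR; rewrite -leNgt => le.
  by rewrite max_r // subr_le0.
have leq : b * sqnorm q <= energy q.
  apply: energy_supp => [x|]; first by rewrite le_max lexx orbT.
  apply: leq_trans ltc; rewrite leq_mul2l /=; apply/subset_leq_card/fintype.subsetP => x.
  rewrite !inE /q; apply: contraR; rewrite -leNgt => le.
  by rewrite max_r // subr_le0.
have pq x : phi x - c = p x - q x /\ p x * q x = 0.
  rewrite /p /q; case: (leP (phi x - c) 0) => h1; case: (leP (c - phi x) 0) => h2;
   split; lra.
have pq0 x : 0 <= p x /\ 0 <= q x by rewrite !le_max !lexx !orbT.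
apply: (@le_trans _ _ (b * (sqnorm p + sqnorm q))).
  apply: ler_wpM2l; first by rewrite divr_ge0 ?sqr_ge0.
  rewrite -big_split /=.
  apply: (@le_trans _ _ (\sum_x (phi x ^+ 2 + ((- 2 * c) * phi x + c ^+ 2)))).
    rewrite big_split /= lerDl big_split /= -mulr_sumr sum0 mulr0 add0r.
    by apply: sumr_ge0 => x _; exact: sqr_ge0.
  apply: ler_sum => x _; have [pqx pq0x] := pq x.
  rewrite (_ : phi x ^+ 2 + _ = (phi x - c) ^+ 2); last by ring.
  rewrite pqx (_ : _ ^+ 2 = p x ^+ 2 + q x ^+ 2 - 2 * (p x * q x)); last by ring.
  by rewrite pq0x; lra.
rewrite mulrDr; apply: (le_trans (lerD lep leq)).
rewrite /energy -big_split; apply: ler_sum => x _.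
rewrite -big_split; apply: ler_sum => y _ /=.
rewrite -mulrDr ler_wpM2l ?srw_ge0 //.
have [px px0] := pq x; have [py py0] := pq y.
have -> : phi x - phi y = (p x - q x) - (p y - q y) by rewrite -px -py; ring.
have := mulr_ge0 (pq0 x).1 (pq0 y).2; have := mulr_ge0 (pq0 x).2 (pq0 y).1.
nra.
Qed.

(** Laziness removes the eigenvalues near [-1], about which vertex expansion
says nothing. *)
Lemma sqnorm_act_Lazy phi : \sum_x phi x = 0 ->
  sqnorm (act (kern R (Lazy G)) phi)
    <= (1 - (psi / D%:R) ^+ 2 / 16) * sqnorm phi.
Proof.
move=> sum0.
have energyE : energy phi = 2 * sqnorm phi - 2 * \sum_x phi x * act P phi x.
  have -> : 2 * sqnorm phi = \sum_x \sum_y P x y * phi x ^+ 2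
     + \sum_x \sum_y P x y * phi y ^+ 2.
    by rewrite (sum_srw_l (fun x => phi x ^+ 2)) (sum_srw_r (fun x => phi x ^+ 2));
       rewrite /sqnorm; ring.
  rewrite mulr_sumr -big_split -sumrB; apply: eq_bigr => x _ /=.
  rewrite mulr_sumr mulr_sumr -big_split -sumrB; apply: eq_bigr => y _ /=; ring.
have le : sqnorm (act (kern R (Lazy G)) phi) <=
   2^-1 * sqnorm phi + 2^-1 * \sum_x phi x * act P phi x.
  have : sqnorm (act (kern R (Lazy G)) phi) = 4^-1 * sqnorm phi
     + 2^-1 * \sum_x phi x * act P phi x + 4^-1 * sqnorm (act P phi).
    rewrite /sqnorm !mulr_sumr -!big_split; apply: eq_bigr => x _ /=.
    by rewrite act_Lazy; field.
  move=> ->; have := sqnorm_act_srw reg d_gt0 phi; lra.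
have := poincare sum0; lra.
Qed.

(** Accept the first offer when it is at least as good for [phi]. *)
Definition greedy phi : G -> G * G -> bool := fun _ o => phi o.2 <= phi o.1.

(** The observable [phi] one step earlier, under greedy control: the mean of
the larger of its two offered values, by [boostE]. *)
Definition boost phi := act (kern R (Ctrl (greedy phi))) phi.

Lemma chosen_greedy phi x o : phi (chosen (greedy phi) x o) = Num.max (phi o.1) (phi o.2).
Proof. by rewrite /chosen /greedy; case: leP. Qed.

Lemma boostE phi x :
  boost phi x = \sum_o offer_prob R x o * Num.max (phi o.1) (phi o.2).
Proof. by rewrite /boost act_Ctrl; under eq_bigr do rewrite chosen_greedy. Qed.

(** At [x], let [a] be the proportion of neighbours in [S]. Two offers meet [S]
with probability [a + a * (1 - a)]. The sum of [a] is the size of [S], so the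
gain comes from the vertices with neighbours both in [S] and outside it. Let [I]
be the vertices with all neighbours in [S]; there are at most as many of them as
elements of [S]. The outer boundary of the union of [S] and [I] consists of such
mixed vertices. Using the boundary of this union instead of that of [S] matters
in bipartite graphs, where all the neighbours of a set can lie outside it; the
union is the reason for a bound of a quarter on the size of [S]. *)
Lemma sum_boost_set S : (0 < #|S|)%N -> (4 * #|S| <= #|G|)%N ->
  (1 + psi / D%:R ^+ 2) * #|S|%:R <= \sum_x boost (fun y => (y \in S)%:R) x.
Proof.
move=> S0 S4; pose f y : R := (y \in S)%:R; pose a := act P f.
have f0 y : 0 <= f y by [].
have boostfE x : boost f x = a x + a x * (1 - a x).
  rewrite boostE (eq_bigr (fun o => offer_prob R x o * f o.1 +
     (offer_prob R x o * f o.2 - offer_prob R x o * (f o.1 * f o.2)))); last first.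
    move=> o _; rewrite -mulrBr -mulrDr; congr (_ * _); rewrite /f.
    case: (o.1 \in S); case: (o.2 \in S); rewrite /= ?mulr1n ?mulr0n ?maxxx;
      by rewrite ?(max_l ler01) ?(max_r ler01); ring.
  rewrite big_split /= sumrB !(sum_offer1 reg, sum_offer2 reg) //.
  rewrite (sum_offer (fun y z => f y * f z)) -/a.
  rewrite [X in _ - X](_ : _ = a x * a x); first by ring.
  rewrite /a /act mulr_suml; apply: eq_bigr => y _; rewrite mulr_sumr mulr_sumr.
  by apply: eq_bigr => z _; ring.
have a1 x : a x <= 1.
  rewrite -(sum_srw R reg d_gt0 x); apply: ler_sum => y _.
  by rewrite ler_piMr ?srw_ge0 // /f; case: (y \in S).
have a0 x : 0 <= a x by apply: sumr_ge0 => y _; rewrite mulr_ge0 ?srw_ge0.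
pose I := [set x : G | [forall y, edge x y ==> (y \in S)]].
have leIS : (#|I| <= #|S|)%N.
  rewrite -(ler_nat R) -!sum_in_card -[X in _ <= X]sum_act_srw.
  apply: ler_sum => x _; case: (boolP (x \in I)) => [|_]; last exact: a0.
  rewrite inE => /forallP xI.
  apply: (@le_trans _ _ (\sum_y P x y)); first by rewrite (sum_srw R reg).
  rewrite le_eqVlt; apply/orP; left; apply/eqP; apply: eq_bigr => y _.
  by have := xI y; rewrite /srw /f; case: (edge x y) => [/= ->|_];
    rewrite /= ?mulr1n ?mulr0n ?mulr1 ?mul0r.
pose T := S :|: I.
have T0 : (0 < #|T|)%N by apply: leq_trans S0 (subset_leq_card (finset.subsetUl _ _)).
have T2 : (2 * #|T| <= #|G|)%N.
  have : (#|T| <= #|S| + #|I|)%N by exact: leq_card_setU.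
  by move: leIS S4; clear; move: #|T| #|S| #|I| #|G| => a b c e; lia.
have sub : nbrs T :\: T \subset nbrs S :\: I.
  apply/fintype.subsetP => x; rewrite !inE negb_or => /andP[/andP[xS xI]].
  case/exists_inP => s sT xs; rewrite xI /=; apply/exists_inP; exists s => //.
  move: sT; rewrite inE => /orP[//|]; rewrite inE => /forallP /(_ x).
  by rewrite edge_sym xs (negPf xS).
have psiS : psi * #|S|%:R <= #|nbrs S :\: I|%:R.
  apply: le_trans (_ : #|nbrs T :\: T|%:R <= _); last first.
    by rewrite ler_nat subset_leq_card.
  apply: le_trans (expansion T0 T2); rewrite ler_pM2l // ler_nat.
  by rewrite subset_leq_card ?finset.subsetUl.
have -> : \sum_x boost (fun y => (y \in S)%:R) x = #|S|%:R + \sum_x a x * (1 - a x).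
  by rewrite -sum_in_card -(sum_act_srw f) -big_split;
    apply: eq_bigr => x _; exact: boostfE.
rewrite mulrDl mul1r lerD2l mulrAC.
apply: (@le_trans _ _ (#|nbrs S :\: I|%:R / D%:R ^+ 2)).
  by rewrite ler_wpM2r ?invr_ge0 ?exprn_ge0.
rewrite -sum_in_card mulr_suml; apply: ler_sum => x _.
case: (boolP (x \in nbrs S :\: I)) => [|_]; last first.
  by rewrite mul0r mulr_ge0 ?a0 ?subr_ge0 ?a1.
rewrite !inE negb_forall => /andP[/existsP[y]].
rewrite negb_imply => /andP[xy yS] /exists_inP[s sS xs].
rewrite mul1r expr2 invfM ler_pM ?invr_ge0 ?(ltW DR_gt0) //.
  apply: (le_trans leDd); apply: le_trans (sum_srw_term x s f0).
  by rewrite srw_edge // /f sS mulr1.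
apply: (le_trans leDd); rewrite -(srw_edge xy).
rewrite -(sum_srw R reg d_gt0 x) -sumrB (bigD1 y) //= /f (negPf yS) mulr0 subr0.
rewrite lerDl; apply: sumr_ge0 => z _; rewrite subr_ge0 ler_piMr ?srw_ge0 //.
by case: (z \in S).
Qed.

Lemma sum_boost_ge phi : (forall x, 0 <= phi x) ->
    (4 * #|[set x | phi x != 0%R]| <= #|G|)%N ->
  (1 + psi / D%:R ^+ 2) * \sum_x phi x <= \sum_x boost phi x.
Proof.
move=> phi0 le4; have {le4} le4 : (#|[set x | phi x != 0%R]| <= #|G| %/ 4)%N by lia.
move: phi phi0 le4; apply: layer_ind.
  rewrite big1 // mulr0; apply: sumr_ge0 => x _; rewrite boostE.
  by apply: sumr_ge0 => o _; rewrite mulr_ge0 ?offer_prob_ge0 // maxxx.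
move=> c S phi c0 /andP[S0 SN] phi0 phiS IH.
have boostD x : boost (fun x => c * (x \in S)%:R + phi x) x
    = c * boost (fun y => (y \in S)%:R) x + boost phi x.
  rewrite !boostE mulr_sumr -big_split; apply: eq_bigr => o _ /=.
  rewrite mulrCA -mulrDr; congr (_ * _).
  case: (boolP (o.1 \in S)) (phi0 o.1) (phiS o.1) => xS px0 px;
   case: (boolP (o.2 \in S)) (phi0 o.2) (phiS o.2) => yS py0 py.
  - by rewrite maxxx !mulr1 -addr_maxr.
  - by rewrite py // mulr1 mulr0 add0r !max_l ?mulr1 // ?addr_ge0.
  - by rewrite px // mulr1 mulr0 add0r !max_r ?mulr1 // ?addr_ge0.
  - by rewrite px // py // !mulr0 !maxxx !mulr0.
rewrite (eq_bigr _ (fun x _ => boostD x)) !big_split /= -!mulr_sumr sum_in_card.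
rewrite mulrDr lerD // mulrCA ler_wpM2l // sum_boost_set //.
by apply: (@leq_trans (4 * (#|G| %/ 4))%N); lia.
Qed.

End Expansion.

(** * Plans and the set of vertices left to visit *)

Section Plans.
Variables (R : realType) (G : graph) (d : nat).
Hypotheses (reg : forall x : G, degree x = d) (d_gt0 : (0 < d)%N).
Implicit Types (Psi : {set G} -> G -> R) (U W : {set G}) (x y z : G).
Implicit Types (ks : seq (move G)) (phi : G -> R).

(** [Psi U x] is a payoff that depends on the set [U] left to visit and on the
position [x]; [run ks Psi U x] is its expected value after the plan [ks]. *)
Definition step (k : move G) Psi : {set G} -> G -> R :=
  fun U x => act (kern R k) (fun y => Psi (U :\ y) y) x.

Definition run ks Psi := foldr step Psi ks.

Lemma run_cat ks1 ks2 Psi : run (ks1 ++ ks2) Psi = run ks1 (run ks2 Psi).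
Proof. by rewrite /run foldr_cat. Qed.

Lemma run_le ks (Psi Psi' : {set G} -> G -> R) :
    (forall U x, x \notin U -> Psi U x <= Psi' U x) ->
  forall U x, x \notin U -> run ks Psi U x <= run ks Psi' U x.
Proof.
move=> le; elim: ks => //= k ks IH U x xU; apply: act_le => y.
by apply: IH; rewrite !inE eqxx.
Qed.

Lemma run_lin ks a b (Psi Psi' : {set G} -> G -> R) U x :
  run ks (fun U x => a * Psi U x + b * Psi' U x) U x
  = a * run ks Psi U x + b * run ks Psi' U x.
Proof.
elim: ks U x => //= k ks IH U x; rewrite -act_lin.
by apply: eq_bigr => y _; rewrite IH.
Qed.

Lemma run_const ks a U x : run ks (fun _ _ => a) U x = a.
Proof.
elim: ks U x => //= k ks IH U x; rewrite -[RHS](act_const reg d_gt0 k a x).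
by apply: eq_bigr => y _; rewrite IH.
Qed.

Definition mono Psi := forall U W x, U \subset W -> Psi U x <= Psi W x.

Lemma run_mono ks Psi : mono Psi -> mono (run ks Psi).
Proof.
move=> mPsi; elim: ks => //= k ks IH U W x UW; apply: act_le => y.
by apply: IH; exact: finset.setSD.
Qed.

(** For a payoff that can only decrease as more vertices are visited, forgetting
all the visits but the final one gives an upper bound, which depends on the law
of the final position alone. *)
Lemma run_acts ks Psi U x : mono Psi -> x \notin U ->
  run ks Psi U x <= acts ks (fun z => Psi (U :\ z) z) x.
Proof.
move=> mPsi; elim: ks U x => [|k ks IH] U x xU /=.
  by apply: mPsi; rewrite finset.subsetD1 subxx.
apply: act_le => y; apply: le_trans (IH _ _ _) _; first by rewrite !inE eqxx.
apply: acts_le => z; apply: mPsi; apply: finset.setSD; exact: finset.subD1set.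
Qed.

(** A plan with at least one move ends at a vertex that it has removed from
[U], so the start may belong to [U] here. *)
Lemma run_acts_cons k ks Psi U x : mono Psi ->
  run (k :: ks) Psi U x <= acts (k :: ks) (fun z => Psi (U :\ z) z) x.
Proof.
move=> mPsi /=; apply: act_le => y; apply: le_trans (run_acts _ mPsi _) _.
  by rewrite !inE eqxx.
apply: acts_le => z; apply: mPsi; apply: finset.setSD; exact: finset.subD1set.
Qed.

Definition card_left U x : R := #|U|%:R.

Lemma card_left_mono : mono card_left.
Proof. by move=> U W x UW; rewrite ler_nat subset_leq_card. Qed.

Definition indicator U : G -> R := fun y => (y \in U)%:R.

Lemma acts_sum ks J (F : nat -> G -> R) x :
  acts ks (fun y => \sum_(i < J) F i y) x = \sum_(i < J) acts ks (F i) x.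
Proof.
elim: J => [|J IH].
  rewrite big_ord0 -[RHS](acts_const reg d_gt0 ks 0 x); congr (acts _ _ _).
  by apply/funext => y; rewrite big_ord0.
rewrite big_ord_recr /= -IH.
have := acts_lin ks 1 1 (fun y => \sum_(i < J) F i y) (F J) x.
rewrite !mul1r => <-; congr (acts _ _ _).
by apply/funext => y; rewrite big_ord_recr /= !mul1r.
Qed.

Lemma actsD ks (phi psi : G -> R) x :
  acts ks (fun y => phi y + psi y) x = acts ks phi x + acts ks psi x.
Proof.
have := acts_lin ks 1 1 phi psi x; rewrite !mul1r => <-; congr (acts _ _ _).
by apply/funext => y; rewrite !mul1r.
Qed.

Lemma actsB ks (phi psi : G -> R) x :
  acts ks (fun y => phi y - psi y) x = acts ks phi x - acts ks psi x.
Proof.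
have := acts_lin ks 1 (-1) phi psi x; rewrite !mul1r mulN1r => <-.
by congr (acts _ _ _); apply/funext => y; rewrite mul1r mulN1r.
Qed.

Lemma acts_ge0 ks phi x : (forall y, 0 <= phi y) -> 0 <= acts ks phi x.
Proof.
by move=> phi0; rewrite -(acts_const reg d_gt0 ks 0 x); apply: acts_le.
Qed.

Definition repeat_moves i ks : seq (move G) := flatten (nseq i ks).

Arguments repeat_moves : simpl never.
Arguments acts : simpl never.

Lemma repeat_movesD i j ks :
  repeat_moves (i + j) ks = repeat_moves i ks ++ repeat_moves j ks.
Proof. by rewrite /repeat_moves nseqD flatten_cat. Qed.

Lemma repeat_movesS i ks : repeat_moves i.+1 ks = ks ++ repeat_moves i ks.
Proof. by []. Qed.

Lemma repeat_movesSr i ks : repeat_moves i.+1 ks = repeat_moves i ks ++ ks.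
Proof. by rewrite -addn1 repeat_movesD /repeat_moves /= cats0. Qed.

(** Only the visits at the ends of the blocks are counted, and a vertex hit
at the ends of two blocks is counted twice. The correction [rho] bounds the
expected number of later returns to the vertex where a block ends, by
Bonferroni's inequality. *)
Lemma run_repeat J k ks rho U x :
    (forall y, \sum_(i < J.-1)
       acts (repeat_moves i.+1 (k :: ks)) (dirac_fun R y) y <= rho) ->
  run (repeat_moves J (k :: ks)) card_left U x
    <= #|U|%:R - \sum_(i < J) acts (repeat_moves i.+1 (k :: ks)) (indicator U) x
       + J%:R * rho.
Proof.
set blk := k :: ks.
elim: J U x => [|J IH] U x hrho; first by rewrite big_ord0 /repeat_moves /= /card_left; lra.
have dirac_ge0 y i : 0 <= acts (repeat_moves i blk) (dirac_fun R y) y.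
  by apply: acts_ge0 => z; rewrite /dirac_fun.
have hrho' y : \sum_(i < J.-1) acts (repeat_moves i.+1 blk) (dirac_fun R y) y <= rho.
  apply: le_trans (hrho y) => /=; case: (J) => // J'.
  by rewrite [X in _ <= X]big_ord_recr lerDl; exact: dirac_ge0.
rewrite repeat_movesS run_cat.
apply: le_trans (run_acts_cons _ _ _ _ (run_mono _ card_left_mono)) _.
apply: (@le_trans _ _ (acts blk (fun z => (#|U|%:R + J.+1%:R * rho) -
    (indicator U z + \sum_(i < J) acts (repeat_moves i.+1 blk) (indicator U) z)) x)).
  apply: acts_le => z; apply: le_trans (IH _ _ hrho') _.
  have cardU : #|U|%:R = #|U :\ z|%:R + indicator U z :> R.
    by rewrite (cardsD1 z U) natrD addrC.
  have : \sum_(i < J) acts (repeat_moves i.+1 blk) (indicator U) z <=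
     \sum_(i < J) acts (repeat_moves i.+1 blk) (indicator (U :\ z)) z + rho.
    apply: le_trans (lerD (lexx _) (hrho z)); rewrite /= -big_split.
    apply: ler_sum => i _ /=; rewrite -actsD; apply: acts_le => y.
    rewrite /indicator /dirac_fun !inE eq_sym.
    by case: eqP; case: (y \in U); rewrite //= ?addr0 ?add0r.
  rewrite cardU -natr1; lra.
rewrite actsB (acts_const reg) // actsD.
rewrite (acts_sum _ _ (fun i => acts (repeat_moves i.+1 blk) (indicator U))).
rewrite big_ord_recl /= [X in _ <= _ - (X + _) + _](_ : _ = acts blk (indicator U) x);
  last by rewrite /repeat_moves /= cats0.
rewrite [X in _ <= _ - (_ + X) + _](_ : _ =
  \sum_(i < J) acts blk (acts (repeat_moves i.+1 blk) (indicator U)) x); last first.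
  by apply: eq_bigr => i _; rewrite -acts_cat.
lra.
Qed.

Lemma run_mix_repeat m' J k ks rho U x : x \notin U ->
    (forall y, \sum_(i < J.-1)
       acts (repeat_moves i.+1 (k :: ks)) (dirac_fun R y) y <= rho) ->
  run (nseq m' (Lazy G) ++ repeat_moves J (k :: ks)) card_left U x
    <= #|U|%:R
       - \sum_(i < J) acts (nseq m' (Lazy G) ++ repeat_moves i.+1 (k :: ks)) (indicator U) x
       + J%:R * rho.
Proof.
move=> xU hrho; rewrite run_cat.
apply: le_trans (run_acts _ (run_mono _ card_left_mono) xU) _.
apply: (@le_trans _ _ (acts (nseq m' (Lazy G)) (fun z => (#|U|%:R + J%:R * rho) -
    (\sum_(i < J) acts (repeat_moves i.+1 (k :: ks)) (indicator U) z)) x)).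
  apply: acts_le => z.
  apply: (@le_trans _ _ (run (repeat_moves J (k :: ks)) card_left U z)).
    by apply: run_mono; [exact: card_left_mono|exact: finset.subD1set].
  by have := @run_repeat J k ks rho U z hrho; lra.
rewrite actsB (acts_const reg) //.
rewrite (acts_sum _ _ (fun i => acts (repeat_moves i.+1 (k :: ks)) (indicator U))).
under [X in _ <= _ - X + _]eq_bigr do rewrite acts_cat.
lra.
Qed.

End Plans.

(** * Steering towards a set *)

Section Greedy.
Variables (R : realType) (G : graph) (d : nat).
Hypotheses (reg : forall x : G, degree x = d) (d_gt0 : (0 < d)%N).
Implicit Types (phi : G -> R).

(** The moves that are optimal for ending at a large value of [phi] after [r]
steps; the rule used with [r'] steps to go compares the optimal values for these
[r'] steps. *)
Fixpoint greedy_moves (r : nat) phi : seq (move G) :=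
  if r is r'.+1
  then Ctrl (greedy (iter r' (@boost R G) phi)) :: greedy_moves r' phi else [::].

Definition is_ctrl (k : move G) := if k is Ctrl _ then true else false.

Lemma greedy_moves_ctrl r phi : all is_ctrl (greedy_moves r phi).
Proof. by elim: r. Qed.

Lemma size_greedy_moves r phi : size (greedy_moves r phi) = r.
Proof. by elim: r => //= r ->. Qed.

Lemma acts_greedy_moves r phi : acts (greedy_moves r phi) phi = iter r (@boost R G) phi.
Proof. by elim: r => //= r <-. Qed.

Lemma boost_ge0 phi : (forall x, 0 <= phi x) -> forall x, 0 <= boost phi x.
Proof.
move=> phi0 x; rewrite boostE; apply: sumr_ge0 => o _.
by rewrite mulr_ge0 ?offer_prob_ge0 // le_max phi0.
Qed.

Lemma iter_boost_ge0 r phi : (forall x, 0 <= phi x) ->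
  forall x, 0 <= iter r (@boost R G) phi x.
Proof. by move=> phi0; elim: r => //= r IH; exact: boost_ge0. Qed.

Definition supp phi : {set G} := [set x | phi x != 0].

Lemma supp_boost phi : supp (boost phi) \subset nbrs (supp phi).
Proof.
apply/fintype.subsetP => x; rewrite !inE; apply: contraR => H.
have zero y : edge x y -> phi y = 0.
  move=> xy; apply/eqP; apply: contraR H => py; apply/exists_inP; exists y => //.
  by rewrite inE.
rewrite boostE big1 // => o _; rewrite /offer_prob; case: ifPn => [/andP[e1 e2]|_].
  by rewrite !zero // maxxx mulr0.
by rewrite mul0r.
Qed.

Lemma card_nbrs (S : {set G}) : (#|nbrs S| <= d * #|S|)%N.
Proof.
have dR : 0 < d%:R :> R by rewrite ltr0n.
rewrite -(ler_nat R) natrM -ler_pdivrMl // -!sum_in_card.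
rewrite -[X in _ <= X](sum_act_srw reg d_gt0) mulr_sumr; apply: ler_sum => x _.
have f0 (z : G) : 0 <= (z \in S)%:R :> R by [].
case: (boolP (x \in nbrs S)) => [|_]; last first.
  by rewrite mulr0; apply: sumr_ge0 => y _; rewrite mulr_ge0 ?srw_ge0.
rewrite inE => /exists_inP[s sS xs].
by apply: le_trans (sum_srw_term x s f0); rewrite (srw_edge R reg xs) sS mulr1n.
Qed.

Lemma card_supp_iter r phi :
  (#|supp (iter r (@boost R G) phi)| <= d ^ r * #|supp phi|)%N.
Proof.
elim: r => [|r IH]; first by rewrite mul1n.
rewrite iterS expnS -mulnA.
apply: (leq_trans (subset_leq_card (supp_boost _))).
by apply: (leq_trans (card_nbrs _)); rewrite leq_mul2l IH orbT.
Qed.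

Variables (D : nat) (psi : R).
Hypotheses (dD : (d <= D)%N) (psi_gt0 : 0 < psi).
Hypothesis expansion : forall S : {set G}, (0 < #|S|)%N ->
  (2 * #|S| <= #|G|)%N -> psi * #|S|%:R <= #|nbrs S :\: S|%:R.

(** While the support has room to spread, each step of greedy control
multiplies the total hitting probability by a constant. *)
Lemma sum_iter_boost_ge r (U : {set G}) :
    (0 < r -> 4 * (D ^ r * #|U|) <= #|G|)%N ->
  (1 + psi / D%:R ^+ 2) ^+ r * #|U|%:R <= \sum_x iter r (@boost R G) (@indicator R G U) x.
Proof.
elim: r => [|r IH] le4; first by rewrite mul1r sum_in_card.
have D1 : (0 < D)%N by exact: leq_trans dD.
have {}le4 : (4 * (D ^ r * #|U|) <= #|G|)%N.
  apply: leq_trans (le4 isT); rewrite leq_mul2l /= leq_mul2r.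
  by rewrite leq_pexp2l ?orbT.
rewrite exprS -mulrA.
apply: (@le_trans _ _ ((1 + psi / D%:R ^+ 2) *
    \sum_x iter r (@boost R G) (@indicator R G U) x)).
  rewrite ler_pM2l ?IH //.
  by rewrite addr_gt0 // divr_gt0 // exprn_gt0 // ltr0n.
apply: sum_boost_ge dD psi_gt0 expansion _ _ _ => //.
  by apply: iter_boost_ge0 => x; rewrite /indicator.
apply: leq_trans le4; rewrite leq_mul2l /=.
apply: (leq_trans (card_supp_iter _ _)); rewrite leq_mul //.
  by clear -dD; case: r => // r; rewrite leq_exp2r.
rewrite subset_leq_card //; apply/fintype.subsetP => x.
by rewrite inE /indicator; case: (x \in U) => //; rewrite eqxx.
Qed.

End Greedy.

(** * Mixing, and the rarity of returns *)

Section Mixing.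
Variables (R : realType) (G : graph) (d : nat).
Hypotheses (reg : forall x : G, degree x = d) (d_gt0 : (0 < d)%N).
Variable gam : R.
Hypothesis gam_ge0 : 0 <= gam.
Hypothesis contract : forall phi : G -> R, \sum_x phi x = 0 ->
  sqnorm (act (kern R (Lazy G)) phi) <= gam * sqnorm phi.
Implicit Types (phi mu : G -> R).

Notation n := (#|G|%:R : R).
Notation lazy m := (nseq m (Lazy G)).

Hypothesis G_gt0 : (0 < #|G|)%N.
Let n_gt0 : 0 < n. Proof. by rewrite ltr0n. Qed.

Definition dev mu : G -> R := fun y => mu y - n^-1.

Lemma sum_cst (c : R) : \sum_(x : G) c = n * c.
Proof. by rewrite sumr_const mulr_natl. Qed.

Lemma sum_dev mu : \sum_x mu x = 1 -> \sum_x dev mu x = 0.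
Proof.
move=> mu1; rewrite sumrB mu1 sum_cst.
by rewrite divff ?subrr // gt_eqF.
Qed.

Lemma sqnorm_dev mu : \sum_x mu x = 1 -> sqnorm mu = n^-1 + sqnorm (dev mu).
Proof.
move=> mu1; have := sum_dev mu1; rewrite /sqnorm => dev0.
rewrite (eq_bigr (fun x => dev mu x ^+ 2 + (2 * n^-1 * dev mu x + n^-1 ^+ 2))).
  rewrite !big_split /= -mulr_sumr dev0 sum_cst.
  by field; rewrite gt_eqF.
by move=> x _; rewrite /dev; ring.
Qed.

Lemma dev_push_Lazy mu :
  dev (push (kern R (Lazy G)) mu) = act (kern R (Lazy G)) (dev mu).
Proof.
rewrite (push_Lazy reg); apply/funext => x; rewrite /dev !act_Lazy.
rewrite [X in _ = _ * (_ + X)](_ : _ = act (@srw R G) mu x - n^-1); first by field;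
  rewrite gt_eqF.
rewrite /act -[X in _ = _ - X]mul1r -(sum_srw R reg d_gt0 x) mulr_suml -sumrB.
by apply: eq_bigr => y _; rewrite mulrBr.
Qed.

Lemma sqnorm_dev_lazy m mu : \sum_x mu x = 1 ->
  sqnorm (dev (pushes (lazy m) mu)) <= gam ^+ m * sqnorm (dev mu).
Proof.
elim: m mu => [|m IH] mu mu1; first by rewrite mul1r.
rewrite /= -/(pushes _ _); apply: le_trans (IH _ _) _.
  by rewrite (sum_push reg).
rewrite exprSr -mulrA ler_wpM2l ?exprn_ge0 // dev_push_Lazy.
by apply: contract; exact: sum_dev.
Qed.

Lemma sqnorm_dev_le mu : \sum_x mu x = 1 -> sqnorm (dev mu) <= sqnorm mu.
Proof. by move=> /sqnorm_dev ->; rewrite lerDr invr_ge0 ler0n. Qed.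

Lemma sqnorm_pushes_ctrl ks mu : all (@is_ctrl G) ks -> (forall x, 0 <= mu x) ->
  sqnorm (pushes ks mu) <= 4 ^+ size ks * sqnorm mu.
Proof.
elim: ks mu => [|[|s] ks IH] mu //=; first by rewrite mul1r.
move=> kc mu0; apply: le_trans (IH _ kc _) _; first exact: push_ge0.
rewrite exprSr -mulrA ler_wpM2l ?exprn_ge0 //.
exact: (sqnorm_push_Ctrl reg d_gt0).
Qed.

Variables (m r : nat) (ks : seq (move G)) (eta : R).
Hypotheses (ks_ctrl : all (@is_ctrl G) ks) (ks_size : size ks = r).
Hypotheses (eta_ge0 : 0 <= eta) (eta_le : eta <= 4^-1).
Hypothesis theta_le : 4 ^+ r * gam ^+ m <= eta ^+ 2.

Notation blk := (lazy m ++ ks).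

(** A block first pulls the law towards the uniform one, then lets control
spoil it; [theta_le] says that the first effect wins. *)
Lemma sqnorm_block mu : (forall x, 0 <= mu x) -> \sum_x mu x = 1 ->
  sqnorm (pushes blk mu) <= 4 ^+ r / n + eta ^+ 2 * sqnorm mu.
Proof.
move=> mu0 mu1; rewrite pushes_cat.
apply: (@le_trans _ _ (4 ^+ r * sqnorm (pushes (lazy m) mu))).
  by rewrite -ks_size; apply: sqnorm_pushes_ctrl => //; exact: pushes_ge0.
rewrite sqnorm_dev ?(sum_pushes reg) // mulrDr lerD2l.
apply: (@le_trans _ _ (4 ^+ r * (gam ^+ m * sqnorm mu))).
  rewrite ler_pM2l ?exprn_gt0 //; apply: le_trans (sqnorm_dev_lazy m mu1) _.
  by rewrite ler_wpM2l ?exprn_ge0 // sqnorm_dev_le.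
by rewrite mulrA ler_wpM2r ?sqnorm_ge0.
Qed.

Lemma sqnorm_repeat i mu : (forall x, 0 <= mu x) -> \sum_x mu x = 1 ->
  sqnorm (pushes (repeat_moves i blk) mu)
    <= 2 * 4 ^+ r / n + (eta ^+ i) ^+ 2 * sqnorm mu.
Proof.
move=> mu0 mu1; have A0 : 0 <= 4 ^+ r / n by rewrite divr_ge0 ?exprn_ge0 ?ler0n.
elim: i => [|i IH]; first by rewrite expr1n mul1r lerDr -mulrA mulr_ge0.
rewrite repeat_movesSr pushes_cat; apply: le_trans (sqnorm_block _ _) _.
- exact: pushes_ge0.
- by rewrite (sum_pushes reg).
have : eta ^+ 2 * sqnorm (pushes (repeat_moves i blk) mu) <=
   eta ^+ 2 * (2 * 4 ^+ r / n + (eta ^+ i) ^+ 2 * sqnorm mu).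
  by rewrite ler_wpM2l ?sqr_ge0.
rewrite mulrDr mulrA -exprMn -exprS.
have : eta ^+ 2 * (2 * 4 ^+ r / n) <= 4 ^+ r / n.
  rewrite (_ : _ * _ = (2 * eta ^+ 2) * (4 ^+ r / n)); last by ring.
  have : eta * eta <= 4^-1 * 4^-1 by rewrite ler_pM.
  by move=> ee; rewrite ler_piMl // expr2; lra.
lra.
Qed.

(** Returning to the starting vertex after whole blocks is unlikely, which is
what keeps the visits counted at the ends of the blocks mostly distinct. *)
Lemma return_le B i y : 0 <= B -> 2 * 4 ^+ r / n <= B ^+ 2 ->
  acts (repeat_moves i blk) (dirac_fun R y) y <= B + eta ^+ i.
Proof.
move=> B0 hB; rewrite acts_dirac sum_mul_dirac.
have dirac0 x : 0 <= dirac_fun R y x by rewrite /dirac_fun.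
have dirac1 : \sum_x dirac_fun R y x = 1.
  by rewrite -[RHS](sum_dirac_mul y (fun=> 1)); apply: eq_bigr => x _; rewrite mulr1.
have e0 : 0 <= eta ^+ i by rewrite exprn_ge0.
have := sqnorm_repeat i dirac0 dirac1; rewrite sqnorm_dirac mulr1.
have := sqr_le_sqnorm (pushes (repeat_moves i blk) (dirac_fun R y)) y.
have : 0 <= pushes (repeat_moves i blk) (dirac_fun R y) y by exact: pushes_ge0.
move: (sqnorm _) (pushes _ _ _) => e p p0 pe ee.
rewrite -ler_sqr ?nnegrE ?addr_ge0 // sqrrD.
have : 0 <= B * eta ^+ i by rewrite mulr_ge0.
by move: ee pe hB; rewrite -mulr_natr; lra.
Qed.

Lemma sum_return_le B J y : 0 <= B -> 2 * 4 ^+ r / n <= B ^+ 2 ->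
  \sum_(i < J) acts (repeat_moves i.+1 blk) (dirac_fun R y) y <= J%:R * B + 2 * eta.
Proof.
move=> B0 hB.
apply: (@le_trans _ _ (\sum_(i < J) (B + eta ^+ i.+1))).
  by apply: ler_sum => i _; exact: return_le.
rewrite big_split /= sumr_const card_ord mulr_natl lerD2l.
(* The subtracted term makes the bound inductive, as [eta <= 1/2]. *)
suff : \sum_(i < J) eta ^+ i.+1 <= 2 * eta - 2 * eta ^+ J.+1.
  by move/le_trans; apply; rewrite gerBl mulr_ge0 ?exprn_ge0.
elim: J => [|J IH]; first by rewrite big_ord0 expr1 subrr.
rewrite big_ord_recr /=.
have : eta * eta ^+ J.+1 <= 4^-1 * eta ^+ J.+1 by rewrite ler_wpM2r ?exprn_ge0.
have : 0 <= eta ^+ J.+1 by rewrite exprn_ge0.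
by rewrite -exprS; lra.
Qed.

(** A nearly uniform law sees nearly the mean of [phi]. The error is a
scalar product with the deviation from uniformity, which is small in squared
norm at the beginning of each greedy stretch. *)
Lemma reward_ge phi m' i x :
    (forall y, 0 <= phi y <= 1) -> gam ^+ m' <= n^-1 ->
  7 / 8 * (\sum_y phi y / n) - 8 * eta ^+ 2
    <= acts (lazy m' ++ repeat_moves i blk ++ lazy m) phi x.
Proof.
move=> phi01 hm'; rewrite acts_dirac !pushes_cat.
set mu0 := pushes (lazy m') _; set mu := pushes (repeat_moves i blk) mu0.
have dirac0 z : 0 <= dirac_fun R x z by rewrite /dirac_fun.
have dirac1 : \sum_z dirac_fun R x z = 1.
  by rewrite -[RHS](sum_dirac_mul x (fun=> 1)); apply: eq_bigr => z _; rewrite mulr1.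
have mu0_ge0 : forall z, 0 <= mu0 z by exact: pushes_ge0.
have mu0_1 : \sum_z mu0 z = 1 by rewrite (sum_pushes reg).
have mu_1 : \sum_z mu z = 1 by rewrite (sum_pushes reg).
have nV0 : 0 <= n^-1 by rewrite invr_ge0 ler0n.
have e0 : sqnorm mu0 <= 2 / n.
  rewrite sqnorm_dev // mulr_natl mulr2n lerD2l.
  apply: le_trans (sqnorm_dev_lazy _ dirac1) _.
  apply: le_trans hm'; rewrite ler_piMr ?exprn_ge0 //.
  by apply: le_trans (sqnorm_dev_le dirac1) _; rewrite sqnorm_dirac.
have four : 1 <= 4 ^+ r :> R by rewrite exprn_ege1 // ler1n.
have e1 : sqnorm mu <= 4 * (4 ^+ r / n).
  apply: le_trans (sqnorm_repeat i mu0_ge0 mu0_1) _.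
  have : (eta ^+ i) ^+ 2 * sqnorm mu0 <= sqnorm mu0.
    have eta1 : eta <= 1 by move: eta_le; lra.
    by rewrite ler_piMl ?sqnorm_ge0 // -exprM exprn_ile1.
  have : n^-1 <= 4 ^+ r / n by rewrite ler_peMl.
  lra.
set nu := pushes (lazy m) mu.
have nu_1 : \sum_z nu z = 1 by rewrite (sum_pushes reg).
have dnu : n * sqnorm (dev nu) <= 4 * eta ^+ 2.
  apply: (@le_trans _ _ (n * (gam ^+ m * (4 * (4 ^+ r / n))))).
    rewrite ler_pM2l //; apply: le_trans (sqnorm_dev_lazy _ mu_1) _.
    rewrite ler_wpM2l ?exprn_ge0 //; apply: le_trans e1; exact: sqnorm_dev_le.
  rewrite (_ : _ * _ = 4 * (4 ^+ r * gam ^+ m)); last by field; rewrite gt_eqF.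
  by rewrite ler_pM2l.
have phin : 8^-1 * (\sum_y phi y / n) >= (8 * n)^-1 * sqnorm phi.
  rewrite invfM -mulrA ler_pM2l ?invr_gt0 // mulr_sumr; apply: ler_sum => y _.
  rewrite mulrC ler_wpM2r //; have /andP[p0 p1] := phi01 y.
  by rewrite expr2 ler_piMr.
have AM : - (2 * (n * sqnorm (dev nu)) + (8 * n)^-1 * sqnorm phi)
    <= \sum_y dev nu y * phi y.
  rewrite !mulr_sumr -big_split -sumrN; apply: ler_sum => y _ /=.
  (* The weight leaves an eighth of the mean of [phi] for the second term. *)
  have : 0 <= (8 * n)^-1 * (4 * n * dev nu y + phi y) ^+ 2.
    by rewrite mulr_ge0 ?sqr_ge0 // invr_ge0 mulr_ge0 ?ler0n.
  rewrite (_ : _ * (_ + _) ^+ 2 = 2 * (n * dev nu y ^+ 2) + (8 * n)^-1 * phi y ^+ 2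
     + dev nu y * phi y); last by field; rewrite gt_eqF.
  lra.
have -> : \sum_y nu y * phi y = \sum_y phi y / n + \sum_y dev nu y * phi y.
  by rewrite -big_split; apply: eq_bigr => y _ /=; rewrite /dev; ring.
lra.
Qed.

End Mixing.

(** * The optimal truncated covering time *)

Section Value.
Variables (R : realType) (G : graph) (d : nat).
Hypotheses (reg : forall x : G, degree x = d) (d_gt0 : (0 < d)%N).
Implicit Types (U : {set G}) (x y : G) (ks : seq (move G)).

(** The least expectation, over all strategies, of the minimum of [T] and the
time needed to visit the whole of [U]. *)
Fixpoint value (T : nat) U x : R :=
  if T is T'.+1 then
    if U == finset.set0 then 0 else
    1 + \sum_o offer_prob R x o *
          Num.min (value T' (U :\ o.1) o.1) (value T' (U :\ o.2) o.2)
  else 0.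

Lemma value_set0 T x : value T finset.set0 x = 0.
Proof. by case: T => //= T; rewrite eqxx. Qed.

Lemma value_ge0 T U x : 0 <= value T U x.
Proof.
elim: T U x => //= T IH U x; case: ifP => // _.
rewrite addr_ge0 //; apply: sumr_ge0 => o _.
by rewrite mulr_ge0 ?offer_prob_ge0 // le_min !IH.
Qed.

Lemma value_leS T U x : value T U x <= value T.+1 U x.
Proof.
elim: T U x => [|T IH] U x; first exact: value_ge0.
rewrite [X in X <= _]/= [X in _ <= X]/=; case: ifP => // _.
rewrite lerD2l; apply: ler_sum => o _; rewrite ler_wpM2l ?offer_prob_ge0 //.
by rewrite le_min !ge_min !IH orbT.
Qed.

(** For a lazy move, half of the weight is on not moving, where the value is
unchanged and no time is spent. *)
Lemma value_step T k U x : x \notin U ->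
  value T U x <= 1 + step k (value T) U x.
Proof.
move=> xU; have step_ge0 j : 0 <= step j (value T) U x.
  by apply: sumr_ge0 => y _; rewrite mulr_ge0 ?kern_ge0 ?value_ge0.
have ctrl s : value T U x <= 1 + step (Ctrl s) (value T) U x.
  apply: le_trans (value_leS _ _ _) _ => /=; case: ifP => _.
    by rewrite addr_ge0.
  rewrite lerD2l /step act_Ctrl; apply: ler_sum => o _.
  rewrite ler_wpM2l ?offer_prob_ge0 // /chosen.
  by case: ifP => _; rewrite ge_min lexx ?orbT.
case: k => [|s]; last exact: ctrl.
rewrite /step act_Lazy (_ : U :\ x = U); last first.
  by apply/finset.setP => y; rewrite !inE; case: eqP => // ->; rewrite (negPf xU).
have := ctrl (fun _ _ => true); rewrite /step act_Ctrl /chosen.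
rewrite (sum_offer1 reg d_gt0 x (fun y => value T (U :\ y) y)); lra.
Qed.

Lemma value_run T ks U x : x \notin U ->
  value T U x <= (size ks)%:R + run ks (value T) U x.
Proof.
elim: ks U x => [|k ks IH] U x xU; first by rewrite add0r.
apply: le_trans (value_step T k xU) _; rewrite /= -natr1 -addrA addrCA addrA.
rewrite -addrA lerD2l -(act_const reg d_gt0 k (size ks)%:R x).
rewrite /step -[X in _ <= X](big_split); apply: ler_sum => y _ /=.
by rewrite -mulrDr ler_wpM2l ?kern_ge0 // IH // !inE eqxx.
Qed.

(** Maximum principle: at a point where [value T] exceeds [F] the most, the
plan that makes [F] decrease by more than its length would give a contradiction
with the optimality of [value T]. *)
Lemma value_le_drift (F : nat -> R) :
    (forall j, 0 <= F j) ->
    (forall U x, (0 < #|U|)%N -> x \notin U -> exists ks,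
       (size ks)%:R + run ks (fun W _ => F #|W|) U x < F #|U|) ->
  forall T U x, x \notin U -> value T U x <= F #|U|.
Proof.
move=> F0 drift T U x xU; rewrite leNgt; apply/negP => lt.
pose P (p : {set G} * G) := p.2 \notin p.1.
pose f (p : {set G} * G) := value T p.1 p.2 - F #|p.1|.
have Pux : P (U, x) by [].
have [[W z] Pwz fmax] := arg_maxP f Pux.
have {}fmax (V : {set G}) y : y \notin V -> value T V y <= F #|V| + f (W, z).
  by move=> yV; have := fmax (V, y) yV; rewrite /f /=; lra.
have fpos : 0 < f (W, z) by have := fmax U x xU; lra.
have W0 : (0 < #|W|)%N.
  rewrite lt0n cards_eq0; apply: contraL fpos => /eqP W0; rewrite -leNgt /f /= W0.
  by rewrite value_set0 sub0r oppr_le0.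
have [ks ltks] := drift W z W0 Pwz.
have : value T W z <= (size ks)%:R + (run ks (fun W _ => F #|W|) W z + f (W, z)).
  apply: le_trans (value_run T ks Pwz) _; rewrite lerD2l.
  rewrite -[X in _ <= _ + X](run_const reg d_gt0 ks (f (W, z)) W z).
  have := run_lin ks 1 1 (fun W _ => F #|W|) (fun _ _ => f (W, z)) W z.
  rewrite !mul1r => <-; apply: run_le => // V y yV.
  by rewrite !mul1r; exact: fmax.
have fE : f (W, z) = value T W z - F #|W| by []; lra.
Qed.

(** The sum of [value T] over all states is bounded and cannot grow by a half
infinitely often. *)
Lemma value_stabilizes (B : R) :
    (forall T U x, x \notin U -> value T U x <= B) ->
  exists T, forall U x, x \notin U -> value T.+1 U x <= value T U x + 2^-1.
Proof.
move=> leB; apply: contrapT => none.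
pose tot T := \sum_(p : {set G} * G | p.2 \notin p.1) value T p.1 p.2.
have grow T : tot T + 2^-1 <= tot T.+1.
  have [p pP plt] : exists2 p : {set G} * G, p.2 \notin p.1 &
      value T p.1 p.2 + 2^-1 < value T.+1 p.1 p.2.
    apply: contrapT => noneT; apply: none; exists T => U x xU.
    by rewrite leNgt; apply/negP => lt; apply: noneT; exists (U, x).
  rewrite /tot (bigD1 p) //= [X in _ <= X](bigD1 p) //= addrAC lerD //.
    exact: ltW.
  by apply: ler_sum => q _; exact: value_leS.
have large T : T%:R / 2 <= tot T.
  elim: T => [|T IH].
    by rewrite mul0r; apply: sumr_ge0 => p _; exact: value_ge0.
  by apply: le_trans (grow T); rewrite -natr1 mulrDl mul1r lerD2r.
pose N := Num.bound `|2 * \sum_(p : {set G} * G | p.2 \notin p.1) B|.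
have totB : tot N <= \sum_(p : {set G} * G | p.2 \notin p.1) B.
  by apply: ler_sum => p; exact: leB.
have : 2 * \sum_(p : {set G} * G | p.2 \notin p.1) B < N%:R.
  by apply: le_lt_trans (ler_norm _) _; exact: archi_boundP.
by have := large N; lra.
Qed.

End Value.

Lemma big_tuple_cons (R : nmodType) (T : finType) (n : nat)
    (P : pred (n.+1.-tuple T)) (F : n.+1.-tuple T -> R) :
  \sum_(w | P w) F w = \sum_a \sum_(w | P (cons_tuple a w)) F (cons_tuple a w).
Proof.
rewrite pair_big_dep /=.
rewrite (reindex (fun p : T * n.-tuple T => cons_tuple p.1 p.2)) //=.
exists (fun w => (thead w, behead_tuple w)) => [[a w] _|w _] /=.
  by congr (_, _); apply/val_inj.
by apply/val_inj; rewrite /= [in RHS](tuple_eta w).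
Qed.

(** * The law of the cover time *)

Section Law.
Variables (R : realType) (G : graph) (d : nat).
Hypotheses (reg : forall x : G, degree x = d) (d_gt0 : (0 < d)%N).
Implicit Types (U : {set G}) (x y : G).

Variable sigma : strategy G.

(** The law of the cover time when the past of the walk is taken into account
both for coverage and by the controller; the empty past gives the law in the
definition of the cover time. *)
Definition future_prob (h : history G) x (t : nat) : R :=
  \sum_(os : t.-tuple (G * G) |
      covers (unzip1 h ++ trajectory sigma h x os) &&
      ~~ covers (unzip1 h ++ take t (trajectory sigma h x os)))
    offers_prob R sigma h x os.

Lemma offers_prob_ge0 (h : history G) x os : 0 <= offers_prob R sigma h x os.
Proof.
by elim: os h x => //= o os IH h x; rewrite mulr_ge0 ?offer_prob_ge0.
Qed.

Lemma future_prob_ge0 h x t : 0 <= future_prob h x t.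
Proof. by apply: sumr_ge0 => os _; exact: offers_prob_ge0. Qed.

Lemma future_prob0 h x : future_prob h x 0 =
  (covers (rcons (unzip1 h) x) && ~~ covers (unzip1 h))%:R.
Proof.
rewrite /future_prob big_mkcond (big_pred1 [tuple]) /=; last first.
  by move=> os; rewrite (tuple0 os) /= eqxx.
by rewrite cats1 cats0; case: ifP.
Qed.

Lemma future_probS h x t : future_prob h x t.+1 =
  \sum_o offer_prob R x o *
     future_prob (rcons h (x, o)) (next_vertex sigma h x o) t.
Proof.
rewrite /future_prob big_tuple_cons; apply: eq_bigr => o _.
rewrite mulr_sumr; apply: eq_big => os //=.
by rewrite /unzip1 map_rcons !cat_rcons.
Qed.

Lemma covers_cat (s1 s2 : seq G) : covers s1 -> covers (s1 ++ s2).
Proof.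
by move=> /forallP c; apply/forallP => v; rewrite mem_cat c.
Qed.

Lemma future_prob_covered h x t : covers (unzip1 h) -> future_prob h x t = 0.
Proof.
by move=> c; rewrite /future_prob big1 // => os /andP[_]; rewrite covers_cat.
Qed.

Lemma sum_future_prob_le1 T h x : \sum_(t < T) future_prob h x t <= 1.
Proof.
elim: T h x => [|T IH] h x; first by rewrite big_ord0.
rewrite big_ord_recl /=.
have -> : \sum_(t < T) future_prob h x (bump 0 t) =
   \sum_o offer_prob R x o * \sum_(t < T)
      future_prob (rcons h (x, o)) (next_vertex sigma h x o) t.
  under eq_bigr do rewrite future_probS.
  by rewrite exchange_big /=; apply: eq_bigr => o _; rewrite mulr_sumr.
rewrite future_prob0; have [c|nc] := boolP (covers (rcons (unzip1 h) x)).
  rewrite [X in _ + X]big1 ?addr0; last first.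
    move=> o _; rewrite big1 ?mulr0 // => t _; rewrite future_prob_covered //.
    by rewrite /unzip1 map_rcons.
  by case: covers.
rewrite add0r -(sum_offer_prob R reg d_gt0 x); apply: ler_sum => o _.
by rewrite ler_piMr ?offer_prob_ge0.
Qed.

Lemma size_trajectory h x os : size (trajectory sigma h x os) = (size os).+1.
Proof. by elim: os h x => //= o os IH h x; rewrite IH. Qed.

Lemma covers_size (w : seq G) : covers w -> (#|G| <= size w)%N.
Proof.
move=> /forallP c; apply: leq_trans (card_size w).
by apply: subset_leq_card; apply/fintype.subsetP => v _; exact: c.
Qed.

Lemma cover_time_prob_small x t : (t.+1 < #|G|)%N -> cover_time_prob R sigma x t = 0.
Proof.
move=> lt; rewrite /cover_time_prob big1 // => os /andP[/covers_size].
by rewrite size_trajectory size_tuple leqNgt lt.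
Qed.

End Law.

(** * From a supersolution to a strategy *)

Section Control.
Variables (R : realType) (G : graph) (d : nat).
Hypotheses (reg : forall x : G, degree x = d) (d_gt0 : (0 < d)%N).
Implicit Types (U : {set G}) (x y : G).

Variable Phi : {set G} -> G -> R.

Definition unvisited (w : seq G) : {set G} := [set v | v \notin w].

(** The set left to visit is read off from the history, then the offer with the
smaller value of [Phi] is accepted. *)
Definition follow : strategy G := fun h x o =>
  let U := unvisited (rcons (unzip1 h) x) in
  Phi (U :\ o.1) o.1 <= Phi (U :\ o.2) o.2.

Hypothesis Phi_ge0 : forall U x, 0 <= Phi U x.
Hypothesis Phi_super : forall U x, (0 < #|U|)%N -> x \notin U ->
  1 + \sum_o offer_prob R x o *
        Num.min (Phi (U :\ o.1) o.1) (Phi (U :\ o.2) o.2) <= Phi U x.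

Notation prob := (future_prob R follow).

(** The left-hand side is the expectation of the cover time truncated at [T].
The claim propagates backwards in time: one step costs [1], and the supersolution
inequality leaves room for exactly that. *)
Lemma truncated_le T (h : history G) x : ~~ covers (unzip1 h) ->
  \sum_(t < T.+1) t%:R * prob h x t + T%:R * (1 - \sum_(t < T.+1) prob h x t)
    <= Phi (unvisited (rcons (unzip1 h) x)) x.
Proof.
elim: T h x => [|T IH] h x nc.
  by rewrite big_ord_recl big_ord0 !mul0r !addr0.
set U := unvisited _.
have next o : unvisited (rcons (unzip1 (rcons h (x, o))) (next_vertex follow h x o))
    = U :\ next_vertex follow h x o.
  apply/finset.setP => v; rewrite !inE /unzip1 map_rcons /= mem_rcons inE.
  by rewrite negb_or.
have [c|nc'] := boolP (covers (rcons (unzip1 h) x)).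
  have prob0 : prob h x 0 = 1 by rewrite future_prob0 c nc.
  have probS t : prob h x t.+1 = 0.
    rewrite future_probS big1 // => o _; rewrite future_prob_covered ?mulr0 //.
    by rewrite /unzip1 map_rcons.
  rewrite big_ord_recl mul0r add0r [X in X + _]big1; last first.
    by move=> t _; rewrite probS mulr0.
  rewrite big_ord_recl prob0.
  have -> : \sum_(t < T.+1) prob h x (lift ord0 t) = 0.
    by rewrite big1 // => t _; rewrite probS.
  by rewrite addr0 subrr mulr0 addr0.
have prob0 : prob h x 0 = 0 by rewrite future_prob0 (negPf nc').
have U0 : (0 < #|U|)%N.
  move: nc'; rewrite /covers negb_forall => /existsP[v vn].
  by apply/card_gt0P; exists v; rewrite inE.
apply: le_trans (Phi_super U0 _); last by rewrite inE mem_rcons inE eqxx.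
rewrite big_ord_recl mul0r add0r [X in _ * (1 - X)]big_ord_recl prob0 add0r.
pose h' o := rcons h (x, o); pose x' o := next_vertex follow h x o.
have -> : \sum_(t < T.+1) (lift ord0 t)%:R * prob h x (lift ord0 t) +
      T.+1%:R * (1 - \sum_(t < T.+1) prob h x (lift ord0 t))
    = 1 + \sum_o offer_prob R x o *
       (\sum_(t < T.+1) t%:R * prob (h' o) (x' o) t +
        T%:R * (1 - \sum_(t < T.+1) prob (h' o) (x' o) t)).
  have e1 : \sum_(t < T.+1) prob h x (lift ord0 t) =
      \sum_o offer_prob R x o * \sum_(t < T.+1) prob (h' o) (x' o) t.
    rewrite (eq_bigr (fun t : 'I_T.+1 =>
      \sum_o offer_prob R x o * prob (h' o) (x' o) t)); last first.
      by move=> t _; rewrite /= future_probS.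
    by rewrite exchange_big /=; apply: eq_bigr => o _; rewrite mulr_sumr.
  have e2 : \sum_(t < T.+1) (lift ord0 t)%:R * prob h x (lift ord0 t) =
      \sum_o offer_prob R x o * \sum_(t < T.+1) t%:R * prob (h' o) (x' o) t
      + \sum_(t < T.+1) prob h x (lift ord0 t).
    rewrite (eq_bigr (fun t : 'I_T.+1 =>
      \sum_o offer_prob R x o * (t%:R * prob (h' o) (x' o) t)
      + prob h x (lift ord0 t))); last first.
      move=> t _; rewrite lift0 -natr1 mulrDl mul1r future_probS mulr_sumr.
      by congr (_ + _); apply: eq_bigr => o _; rewrite mulrCA.
    rewrite big_split /= exchange_big /=; congr (_ + _).
    by apply: eq_bigr => o _; rewrite mulr_sumr.
  rewrite e2 e1.
  under [X in _ = 1 + X]eq_bigr do rewrite mulrDr mulrCA mulrBr mulr1 mulrBr.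
  rewrite big_split sumrB /= -!mulr_sumr (sum_offer_prob R reg d_gt0 x) -natr1.
  ring.
rewrite lerD2l; apply: ler_sum => o _; rewrite ler_wpM2l ?offer_prob_ge0 //.
have cov' : ~~ covers (unzip1 (h' o)) by rewrite /unzip1 map_rcons.
apply: le_trans (IH (h' o) (x' o) cov') _; rewrite next.
rewrite /x' /next_vertex /follow -/U.
by case: (leP (Phi (U :\ o.1) o.1)).
Qed.

End Control.

(** * Expectations of extended natural numbers *)

Section Series.
Variables (R : realType) (p : nat -> R).
Hypotheses (p_ge0 : forall t, 0 <= p t) (p_le1 : forall T, \sum_(t < T) p t <= 1).

Local Notation mass := (\sum_(0 <= t <oo) (p t)%:E)%E.

Let pE_ge0 t : (0%R <= (p t)%:E)%E. Proof. by rewrite lee_fin. Qed.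

Lemma nneseries_le_fin (u : nat -> R) (B : R) : (forall t, 0 <= u t) ->
    (forall T, \sum_(t < T) u t <= B) ->
  (\sum_(0 <= t <oo) (u t)%:E <= B%:E)%E.
Proof.
move=> u0 uB; apply: lime_le.
  by apply: is_cvg_nneseries => t _ _; rewrite lee_fin.
by apply: nearW => T /=; rewrite big_mkord sumEFin lee_fin.
Qed.

Lemma nneseries_ge_fin (u : nat -> R) T : (forall t, 0 <= u t) ->
  ((\sum_(t < T) u t)%:E <= \sum_(0 <= t <oo) (u t)%:E)%E.
Proof.
move=> u0; rewrite -sumEFin -(big_mkord xpredT (fun t => (u t)%:E)).
by apply: nneseries_lim_ge => t _; rewrite lee_fin.
Qed.

Lemma mass_le1 : (mass <= 1)%E.
Proof. exact: nneseries_le_fin. Qed.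

(** The bound on the truncated expectations forces the mass that is not yet
accounted for at time [T] to be at most [B / T]; hence the infinite term of the
expectation vanishes. *)
Lemma expectation_le (B : R) :
    (forall T, \sum_(t < T.+1) t%:R * p t + T%:R * (1 - \sum_(t < T.+1) p t) <= B) ->
  (\sum_(0 <= t <oo) (t%:R * p t)%:E + +oo * (1 - mass) <= B%:E)%E.
Proof.
move=> leB.
have tail_ge0 T : 0 <= T%:R * (1 - \sum_(t < T.+1) p t).
  by rewrite mulr_ge0 // subr_ge0.
have tp_ge0 t : 0 <= t%:R * p t by rewrite mulr_ge0.
have leS : (\sum_(0 <= t <oo) (t%:R * p t)%:E <= B%:E)%E.
  apply: nneseries_le_fin => // T; apply: le_trans (leB T).
  rewrite big_ord_recr /= -addrA lerDl addr_ge0 ?tp_ge0 //.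
have massE : mass = 1%E.
  apply/eqP; rewrite eq_le mass_le1 /=; apply/lee_addgt0Pr => e e0.
  pose T := Num.bound `|B / e|.
  have ltT : B / e < T%:R.
    by apply: le_lt_trans (ler_norm _) (archi_boundP _).
  apply: le_trans (leeD2r _ (nneseries_ge_fin T.+1 p_ge0)).
  rewrite -EFinD lee_fin.
  have : T%:R * (1 - \sum_(t < T.+1) p t) <= B.
    by apply: le_trans (leB T); rewrite lerDr sumr_ge0.
  move: ltT; rewrite ltr_pdivrMr // => ltT le.
  rewrite -lerBlDl leNgt; apply/negP => lt.
  have T0 : 0 < T%:R :> R.
    rewrite lt0r ler0n andbT; apply: contraTN ltT => /eqP ->; rewrite mul0r -leNgt.
    by apply: le_trans le; exact: tail_ge0.
  have : T%:R * e < T%:R * (1 - \sum_(t < T.+1) p t) by rewrite ltr_pM2l.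
  lra.
by rewrite massE subee // mule0 adde0.
Qed.

Lemma expectation_ge (k : nat) : (forall t, (t < k)%N -> p t = 0) ->
  (k%:R%:E <= \sum_(0 <= t <oo) (t%:R * p t)%:E + +oo * (1 - mass))%E.
Proof.
move=> small.
have tp_ge0 t : 0 <= t%:R * p t by rewrite mulr_ge0.
have sum_ge0 : (0 <= \sum_(0 <= t <oo) (t%:R * p t)%:E)%E.
  by apply: nneseries_ge0 => t _ _; rewrite lee_fin.
have := mass_le1; rewrite le_eqVlt => /orP[/eqP mass1|lt1].
  rewrite mass1 subee // mule0 adde0.
  apply: (@le_trans _ _ (k%:R%:E * mass)%E); first by rewrite mass1 mule1.
  rewrite -nneseriesZl //; apply: lee_nneseries => t _.
    by rewrite -EFinM lee_fin mulr_ge0.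
  rewrite -EFinM lee_fin; have [/small ->|le] := ltnP t k; first by rewrite !mulr0.
  by rewrite ler_wpM2r // ler_nat.
rewrite gt0_mulye ?sube_gt0 // addey ?leey //.
by rewrite gt_eqF // (lt_le_trans _ sum_ge0) // ltNyr.
Qed.

End Series.

(** * The cover time between its two bounds *)

Section Bounds.
Variables (R : realType) (G : graph) (d : nat).
Hypotheses (reg : forall x : G, degree x = d) (d_gt0 : (0 < d)%N).
Hypothesis G_gt0 : (0 < #|G|)%N.

Lemma expected_cover_time_ge (sigma : strategy G) (x : G) :
  (#|G|.-1%:R%:E <= expected_cover_time R sigma x)%E.
Proof.
apply: expectation_ge => [t|T|t lt].
- exact: (future_prob_ge0 R sigma [::] x).
- exact: (sum_future_prob_le1 R reg d_gt0 sigma T [::] x).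
- by apply: cover_time_prob_small; lia.
Qed.

Lemma crw_cover_time_ge : (#|G|.-1%:R%:E <= crw_cover_time R G)%E.
Proof.
have /card_gt0P[x _] := G_gt0.
apply: (@le_trans _ _ (ereal_inf (range (fun sigma : strategy G =>
  expected_cover_time R sigma x)))).
  apply/ereal_infP => _ [sigma _ <-]; exact: expected_cover_time_ge.
exact: le_bigmax.
Qed.

(** Where [value T] grows by at most [1/2] in one more step, doubling it turns
the optimality equation for [value T.+1] into the supersolution inequality. *)
Lemma crw_cover_time_le (B : R) :
    (forall T (U : {set G}) x, x \notin U -> value R T U x <= B) ->
  (crw_cover_time R G <= (2 * B)%:E)%E.
Proof.
move=> leB; have [T stab] := value_stabilizes leB.
pose Phi (U : {set G}) x := 2 * value R T U x.
apply: bigmax_le => [|x _]; first exact: leNye.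
apply: (@le_trans _ _ (expected_cover_time R (follow Phi) x)).
  by apply: ereal_inf_lbound; exists (follow Phi).
apply: expectation_le => [t|t|t].
- exact: (future_prob_ge0 R (follow Phi) [::] x).
- exact: (sum_future_prob_le1 R reg d_gt0 (follow Phi) t [::] x).
apply: le_trans (@truncated_le R G d reg d_gt0 Phi _ _ t [::] x _) _.
- by move=> U y; rewrite mulr_ge0 ?value_ge0.
- move=> U y U0 yU; have := stab U y yU.
  rewrite [X in X <= _ + _]/= -cards_eq0 -(negbK (_ == _)) -lt0n U0 /= => le.
  rewrite (eq_bigr (fun o => 2 * (offer_prob R y o *
    Num.min (value R T (U :\ o.1) o.1) (value R T (U :\ o.2) o.2)))); last first.
    by move=> o _; rewrite /Phi -minr_pMr // mulrCA.
  by rewrite -mulr_sumr /Phi; lra.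
- by apply/negP => /forallP /(_ x).
- by rewrite ler_pM2l // leB // !inE negbK.
Qed.

End Bounds.

(** * Sums and growth rates *)

Section Sums.
Variable R : realType.

Lemma exprn_small (g e : R) : 0 <= g < 1 -> 0 < e -> exists m, g ^+ m <= e.
Proof.
move=> /andP[g0 g1] e0.
have g1' : `|g| < 1 by rewrite ger0_norm.
have /cvgr_dist_le /(_ _ e0) [N _ hN] := cvg_expr g1'.
exists N; have := hN N (leqnn N); rewrite /= sub0r normrN ger0_norm //.
by rewrite exprn_ge0.
Qed.

(** A sum of a nonincreasing sequence is concave in the number of terms, hence
lies below each of its tangents. *)
Lemma sum_tangent (a : nat -> R) (w j : nat) :
    (forall i k, (i <= k)%N -> a k <= a i) ->
  \sum_(i < j) a i <= \sum_(i < w.+1) a i + a w * (j%:R - w.+1%:R).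
Proof.
move=> dec; have [le|lt] := leqP w.+1 j.
  rewrite -(subnKC le); elim: (j - w.+1)%N => [|k IH]; first by rewrite addn0; lra.
  rewrite addnS; have : (w <= w.+1 + k)%N by lia.
  move: (w.+1 + k)%N IH => K IH /dec le'.
  by rewrite big_ord_recr -[K.+1%:R]natr1 /=; lra.
move: lt; rewrite ltnS => le; rewrite -(subKn le).
elim: (w - j)%N (leq_subr j w) => [|k IH] kw.
  by rewrite subn0 big_ord_recr /= -natr1; lra.
have {}IH := IH (ltnW kw); move: IH.
rewrite (_ : w - k = (w - k.+1).+1)%N; last by lia.
have : (w - k.+1 <= w)%N by lia.
move: (w - k.+1)%N => K /dec le'.
by rewrite big_ord_recr -[K.+1%:R]natr1 /=; lra.
Qed.

(** The partial sums of the derivative of the geometric series. *)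
Lemma sum_arith_geom (q : R) N : 0 <= q < 1 ->
  \sum_(r < N) r.+1%:R * q ^+ r <= ((1 - q) ^+ 2)^-1.
Proof.
move=> /andP[q0 q1]; have q2 : 0 < (1 - q) ^+ 2 by rewrite exprn_gt0 // subr_gt0.
rewrite -[X in _ <= X]mul1r ler_pdivlMr //.
have -> : (\sum_(r < N) r.+1%:R * q ^+ r) * (1 - q) ^+ 2
    = 1 - (N.+1%:R * q ^+ N - N%:R * q ^+ N.+1).
  elim: N => [|N IH]; first by rewrite big_ord0; ring.
  by rewrite big_ord_recr /= mulrDl IH -!natr1 !exprS; ring.
rewrite gerBl subr_ge0 exprS mulrA ler_wpM2r ?exprn_ge0 //.
apply: le_trans (_ : N%:R <= _); last by rewrite ler_nat.
by rewrite ler_piMr // ltW.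
Qed.

Lemma sum_lt_le n m : (\sum_(j < n) (j < m) <= m)%N.
Proof.
suff -> : (\sum_(j < n) (j < m) = minn n m)%N by rewrite geq_minr.
elim: n => [|n IH]; first by rewrite big_ord0 min0n.
by rewrite big_ord_recr /= IH; case: (ltnP n m); lia.
Qed.

End Sums.

Lemma poly_le_exp c : exists L0, forall L, (L0 <= L)%N -> (c * L.+1 ^ 4 <= 2 ^ L)%N.
Proof.
exists (8 * (c * 8 ^ 4))%N => L le.
set k := (L %/ 8)%N.
have k_ge : (c * 8 ^ 4 <= k)%N by rewrite leq_divRL // mulnC.
have Lk : (L.+1 <= 8 * 2 ^ k)%N.
  have := ltn_expl k (isT : (1 < 2)%N); have := ltn_ceil L (isT : (0 < 8)%N).
  rewrite -/k; lia.
have : (c * L.+1 ^ 4 <= c * 8 ^ 4 * 2 ^ (4 * k))%N.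
  by rewrite -mulnA leq_mul2l (mulnC 4) expnM -expnMn leq_exp2r // Lk orbT.
move=> /leq_trans; apply.
apply: (@leq_trans (2 ^ (4 * k) * 2 ^ (4 * k))%N).
  rewrite leq_mul2r; apply/orP; right; apply: (leq_trans k_ge).
  apply: leq_trans (ltnW (ltn_expl k (isT : (1 < 2)%N))) _.
  by rewrite leq_exp2l //; lia.
by rewrite -expnD leq_exp2l // /k; have := leq_trunc_div L 8; lia.
Qed.

(** * The depth to which control is effective *)

Section Scale.
Variables (D : nat).
Hypothesis D_gt1 : (1 < D)%N.

(** The depth to which a set of size [w] can grow before it fills a quarter of
[n] vertices. *)
Definition depth (n w : nat) := trunc_log D (n %/ (4 * w)).

Lemma depth_le n w : (0 < w)%N -> (0 < depth n w)%N -> (4 * (D ^ depth n w * w) <= n)%N.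
Proof.
move=> w0; rewrite /depth; have [->|q0] := posnP (n %/ (4 * w)).
  by rewrite trunc_log0.
by move=> _; have := trunc_logP D_gt1 q0; rewrite leq_divRL ?muln_gt0 //; nia.
Qed.

Lemma depth_gt n w : (0 < w)%N -> (n < 4 * w * D ^ (depth n w).+1)%N.
Proof.
move=> w0; have := trunc_log_ltn (n %/ (4 * w)) D_gt1.
by rewrite ltn_divLR ?muln_gt0 // mulnC.
Qed.

Lemma depth_anti n i k : (0 < i)%N -> (i <= k)%N -> (depth n k <= depth n i)%N.
Proof.
move=> i0 ik; apply: leq_trunc_log; apply: leq_div2l; first by rewrite muln_gt0.
by rewrite leq_mul2l.
Qed.

Lemma depth_mul_le n w : (0 < w <= n)%N -> (D ^ depth n w * w <= n)%N.
Proof.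
move=> /andP[w0 wn]; have [->|d0] := posnP (depth n w); first by rewrite mul1n.
by have := depth_le w0 d0; lia.
Qed.

Lemma count_depth_le n r : (\sum_(j < n) (depth n j.+1 == r) <= n %/ D ^ r)%N.
Proof.
apply: leq_trans (sum_lt_le n (n %/ D ^ r)); apply: leq_sum => j _.
case: eqP => //= <-; rewrite leq_divRL ?expn_gt0 ?(ltnW D_gt1) //.
by rewrite mulnC depth_mul_le //=.
Qed.

(** If the first alternative fails, [D ^ r] exceeds a fixed power of [n], up to
logarithmic factors, and [r] is at least a constant multiple of [log n]. *)
Lemma regime c : exists C1, forall n r, (0 < n)%N ->
  (c * (trunc_log 2 n).+1 ^ 2 * D ^ (4 * r) <= n)%N
  || ((trunc_log 2 n).+1 <= C1 * r.+1)%N.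
Proof.
have [L0 hL0] := poly_le_exp (c ^ 2).
(* [D <= 2 ^ D] makes [8 * D * r <= L] imply [D ^ (8 * r) <= 2 ^ L]. *)
exists (8 * D + L0.+1)%N => n r n0; set L := trunc_log 2 n.
have Ln : (2 ^ L <= n)%N by exact: trunc_logP.
rewrite orbC -implyNb -ltnNge; apply/implyP => lt.
have L0L : (L0 <= L)%N by nia.
have LDr : (8 * D * r <= L)%N by nia.
apply: leq_trans Ln; rewrite -leq_sqr.
have -> : ((c * L.+1 ^ 2 * D ^ (4 * r)) ^ 2 = c ^ 2 * L.+1 ^ 4 * D ^ (8 * r))%N.
  have -> : (D ^ (8 * r) = (D ^ (4 * r)) ^ 2)%N.
    by rewrite -expnM; congr (_ ^ _)%N; lia.
  have -> : (L.+1 ^ 4 = (L.+1 ^ 2) ^ 2)%N by rewrite -expnM.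
  by rewrite !expnMn.
rewrite -mulnn leq_mul ?hL0 //.
apply: (@leq_trans ((2 ^ D) ^ (8 * r))%N).
  by case: (8 * r)%N => // k; rewrite leq_exp2r // ltnW // ltn_expl.
by rewrite -expnM leq_exp2l //; lia.
Qed.

End Scale.

(** * What one plan gains *)

Section Drift.
Variables (R : realType) (D : nat) (psi : R).
Hypotheses (D_gt1 : (1 < D)%N) (psi_gt0 : 0 < psi) (psi_le1 : psi <= 1).

Let DR_gt1 : 1 < D%:R :> R. Proof. by rewrite ltr1n. Qed.
Let DR_gt0 : 0 < D%:R :> R. Proof. by apply: lt_trans DR_gt1. Qed.

Definition growth : R := 1 + psi / D%:R ^+ 2.
Definition decay : R := 1 - (psi / D%:R) ^+ 2 / 16.

Lemma growth_gt1 : 1 < growth.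
Proof. by rewrite ltrDl divr_gt0 // exprn_gt0. Qed.

Lemma growth_leD : growth <= D%:R.
Proof.
have D2 : 2 <= D%:R :> R by rewrite ler_nat.
apply: le_trans D2; rewrite /growth.
suff : psi / D%:R ^+ 2 <= 1 by lra.
rewrite ler_pdivrMr ?exprn_gt0 // mul1r; apply: le_trans psi_le1 _.
by rewrite exprn_ege1 // ltW.
Qed.

Lemma decay_lt1 : decay < 1.
Proof. by rewrite gtrBl divr_gt0 // exprn_gt0 // divr_gt0. Qed.

Lemma decay_ge0 : 0 <= decay.
Proof.
have : (psi / D%:R) ^+ 2 <= 1.
  rewrite exprn_ile1 ?divr_ge0 ?(ltW psi_gt0) ?ler0n //.
  by rewrite ler_pdivrMr // mul1r (le_trans psi_le1) // ltW.
rewrite /decay; lra.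
Qed.

Section OneGraph.
Variables (G : graph) (d : nat).
Hypotheses (reg : forall x : G, degree x = d) (d_gt0 : (0 < d)%N) (dD : (d <= D)%N).
Hypothesis expansion : forall S : {set G}, (0 < #|S|)%N ->
  (2 * #|S| <= #|G|)%N -> psi * #|S|%:R <= #|nbrs S :\: S|%:R.
Variable m0 : nat.
Hypothesis m0P : decay ^+ m0.+1 <= (4 * (64 * D%:R) ^+ 2)^-1.

Notation n := #|G|.
Notation lazy m := (nseq m (Lazy G)).

Section OneSet.
Variables (U : {set G}) (x : G) (J : nat).
Hypotheses (U_gt0 : (0 < #|U|)%N) (xU : x \notin U).

Let r := depth D n #|U|.
Let L := trunc_log 2 n.
Let m := (m0.+1 * r.+1)%N.
Let m' := (m0.+1 * L.+1)%N.
Let eta : R := ((64 * D%:R) ^+ r.+1)^-1.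
Let f := @indicator R G U.
Let rate : R := \sum_y iter r (@boost R G) f y / n%:R.
Let B : R := Num.sqrt (2 * 4 ^+ r / n%:R).

(** After [m'] lazy steps the law of the walk is uniform up to a relative error
of constant order in squared norm. Then [J] attempts are made, each consisting
of [m] lazy steps and [r] greedy ones. *)
Definition plan : seq (move G) := lazy m' ++ repeat_moves J (lazy m ++ greedy_moves r f).

Lemma size_plan : size plan = (m' + J * (m + r))%N.
Proof.
rewrite /plan size_cat size_nseq /repeat_moves size_flatten /shape map_nseq sumn_nseq.
by rewrite size_cat size_nseq size_greedy_moves mulnC.
Qed.

Let n_gt0 : (0 < n)%N.
Proof. by apply: leq_trans U_gt0 (max_card _). Qed.
Let nR_gt0 : 0 < n%:R :> R. Proof. by rewrite ltr0n. Qed.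

Lemma rate_ge : (4 * D%:R ^+ r.+1)^-1 * growth ^+ r <= rate.
Proof.
apply: (@le_trans _ _ (growth ^+ r * #|U|%:R / n%:R)).
  rewrite mulrC -mulrA ler_wpM2l ?exprn_ge0 ?(ltW (lt_trans _ growth_gt1)) //.
  rewrite ler_pdivlMr // ler_pdivrMl ?mulr_gt0 ?exprn_gt0 //.
  rewrite -natrX -!natrM ler_nat.
  rewrite (_ : _ * _ = 4 * #|U| * D ^ r.+1)%N; last by ring.
  exact: ltnW (depth_gt D_gt1 n U_gt0).
rewrite /rate -mulr_suml ler_wpM2r ?invr_ge0 ?ler0n //.
apply: (sum_iter_boost_ge reg d_gt0 dD psi_gt0 expansion) => r0.
exact: depth_le.
Qed.

Lemma rate_ge_base : (4 * D%:R ^+ r.+1)^-1 <= rate.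
Proof.
apply: le_trans rate_ge; rewrite ler_peMr ?exprn_ege1 ?(ltW growth_gt1) //.
Qed.

Lemma eta_gt0 : 0 < eta.
Proof. by rewrite invr_gt0 exprn_gt0 // mulr_gt0. Qed.

Lemma eta_le_rate : 16 * eta <= rate.
Proof.
apply: le_trans rate_ge_base.
rewrite /eta exprMn invfM [X in _ <= X]invfM mulrA ler_wpM2r //.
rewrite ler_pdivrMr ?exprn_gt0 // exprS mulrA.
rewrite (_ : 4^-1 * 64 = 16); last by lra.
by rewrite ler_peMr // exprn_ege1 // ler1n.
Qed.

Lemma eta_le_quarter : eta <= 4^-1.
Proof.
rewrite lef_pV2 ?posrE ?exprn_gt0 ?mulr_gt0 // exprS.
apply: (@le_trans _ _ (64 * D%:R)); first by have := DR_gt1; lra.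
rewrite ler_peMr ?mulr_ge0 ?exprn_ege1 ?(ltW DR_gt0) //.
by have := DR_gt1; lra.
Qed.

Lemma theta_le_eta : 4 ^+ r * decay ^+ m <= eta ^+ 2.
Proof.
apply: (@le_trans _ _ (4 ^+ r.+1 * ((4 * (64 * D%:R) ^+ 2)^-1) ^+ r.+1)).
  apply: ler_pM; rewrite ?exprn_ge0 ?decay_ge0 //.
    by rewrite ler_eXn2l // ltr1n.
  by rewrite /m exprM lerXn2r // nnegrE ?exprn_ge0 ?decay_ge0 //;
    rewrite invr_ge0 mulr_ge0 // sqr_ge0.
rewrite -exprMn invfM mulrA divff // mul1r /eta -exprVn exprAC -exprVn.
by rewrite le_eqVlt -!exprM mulnC eqxx.
Qed.

Lemma mixed_start : decay ^+ m' <= n%:R^-1.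
Proof.
apply: (@le_trans _ _ (2^-1 ^+ L.+1)).
  rewrite /m' exprM lerXn2r // ?nnegrE ?exprn_ge0 ?decay_ge0 //.
  apply: (le_trans m0P); rewrite lef_pV2 ?posrE ?mulr_gt0 ?exprn_gt0 //.
  have : 1 <= (64 * D%:R) ^+ 2 :> R.
    by rewrite exprn_ege1 //; have := DR_gt1; lra.
  lra.
rewrite exprVn lef_pV2 ?posrE ?exprn_gt0 // -natrX ler_nat.
by apply: ltnW; exact: trunc_log_ltn.
Qed.

(** Of the [7/8] that [reward_ge] secures out of [rate], errors of mixing take
[1/8] and returns take [1/4]. *)
Lemma plan_gain : J.-1%:R * B <= rate / 8 ->
  J%:R * (rate / 2) <= #|U|%:R - run plan (@card_left R G) U x.
Proof.
move=> hB.
have B0 : 0 <= B by exact: sqrtr_ge0.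
have BB : 2 * 4 ^+ r / n%:R <= B ^+ 2.
  by rewrite sqr_sqrtr // divr_ge0 ?mulr_ge0 ?exprn_ge0 ?ler0n.
have contract := @sqnorm_act_Lazy R G d D psi reg d_gt0 dD psi_gt0 expansion.
have ctrls := greedy_moves_ctrl r f; have sz := size_greedy_moves r f.
have ret y := @sum_return_le R G d reg d_gt0 _ decay_ge0 contract n_gt0 m r
  (greedy_moves r f) eta ctrls sz (ltW eta_gt0) eta_le_quarter theta_le_eta B J.-1 y B0 BB.
have f01 y : 0 <= iter r (@boost R G) f y <= 1.
  rewrite iter_boost_ge0 /=; last by move=> z; rewrite /f /indicator.
  rewrite -acts_greedy_moves -[X in _ <= X](acts_const reg d_gt0 (greedy_moves r f) 1 y).
  by apply: acts_le => z; rewrite /f /indicator; case: (z \in U).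
have rew i := @reward_ge R G d reg d_gt0 _ decay_ge0 contract n_gt0 m r
  (greedy_moves r f) eta ctrls sz (ltW eta_gt0) eta_le_quarter theta_le_eta _ m' i x f01
  mixed_start.
have eta2 : 8 * eta ^+ 2 <= rate / 8.
  have := eta_le_rate; have := eta_le_quarter; have := eta_gt0; rewrite expr2.
  move=> e0 e4 er; have : eta * eta <= 4^-1 * eta by rewrite ler_wpM2r // ltW.
  lra.
have [b bE] : {b | lazy m ++ greedy_moves r f = Lazy G :: b}.
  by rewrite /m mulSn addSn /=; eexists.
have gain i : 3 / 4 * rate <=
      acts (lazy m' ++ repeat_moves i.+1 (lazy m ++ greedy_moves r f)) f x.
  rewrite repeat_movesSr !catA acts_cat acts_greedy_moves -catA.
  apply: le_trans (rew i); rewrite -/rate; lra.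
rewrite /plan; move: ret gain; rewrite bE => ret gain.
have := @run_mix_repeat R G d reg d_gt0 m' J (Lazy G) b
   (J.-1%:R * B + 2 * eta) U x xU ret.
have sumgain : J%:R * (3 / 4 * rate) <=
    \sum_(i < J) acts (lazy m' ++ repeat_moves i.+1 (Lazy G :: b)) (indicator R U) x.
  rewrite mulr_natl -[X in _ *+ X]card_ord -sumr_const.
  by apply: ler_sum => i _; exact: gain.
have : J%:R * (J.-1%:R * B + 2 * eta) <= J%:R * (rate / 4).
  by rewrite ler_wpM2l //; have := eta_le_rate; lra.
lra.
Qed.

End OneSet.
End OneGraph.
End Drift.

(** * The total cost is linear *)

Lemma few_blocks_size (a c s l r : nat) : (l <= c * s)%N -> (r <= s)%N ->
  (a * l + 1 * (a * s + r) <= a.+1 * c.+2 * (1 * s))%N.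
Proof.
move=> ls rs; rewrite !mul1n.
apply: (@leq_trans (a.+1 * (c * s) + a.+1 * s)%N).
  by rewrite leq_add ?leq_mul // [X in (_ <= X)%N]mulSn addnC leq_add2r.
by rewrite -mulnDr -mulSnr -mulnA leq_mul2l leq_mul2r leqnSn !orbT.
Qed.

Lemma many_blocks_size (a c s l r : nat) : (0 < s)%N -> (r <= s)%N ->
  (a * l + l * (a * s + r) <= a.+1 * c.+2 * (l * s))%N.
Proof.
move=> s0 rs; rewrite [(a * l)%N]mulnC -mulnDr [X in (_ <= X)%N]mulnCA leq_mul2l.
apply/orP; right; rewrite -mulnA; apply: (@leq_trans (a.+1 * (2 * s))%N); first by nia.
by rewrite leq_mul2l leq_mul2r orbT.
Qed.

(** With [l] blocks the returns due to the uniform part of the law are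
negligible as soon as the right-hand side is at most the number of vertices. *)
Lemma many_blocks_variance (D l r : nat) : (1 < D)%N ->
  ((32 * D ^ r.+1) ^ 2 * (l ^ 2 * (2 * 4 ^ r))
     <= 2 * 32 ^ 2 * D ^ 2 * l ^ 2 * D ^ (4 * r))%N.
Proof.
move=> D1; have le4 : (4 ^ r <= D ^ (2 * r))%N.
  by rewrite expnM; case: (r) => // r'; rewrite leq_exp2r // -[4%N]/(2 ^ 2)%N leq_sqr.
have -> : (D ^ (4 * r) = (D ^ r) ^ 2 * D ^ (2 * r))%N.
  by rewrite -expnM -expnD; congr (_ ^ _)%N; lia.
rewrite (expnS D r); move: (D ^ (2 * r))%N (4 ^ r)%N (D ^ r)%N le4 => b a e ab.
rewrite !expnMn; move: (32 ^ 2)%N (D ^ 2)%N (e ^ 2)%N (l ^ 2)%N => t u v w.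
rewrite [X in (X <= _)%N](_ : _ = 2 * t * u * w * (v * a))%N; last by ring.
by rewrite leq_mul2l leq_mul2l ab !orbT.
Qed.

Section Total.
Variables (R : realType) (D : nat) (psi : R).
Hypotheses (D_gt1 : (1 < D)%N) (psi_gt0 : 0 < psi) (psi_le1 : psi <= 1).

Let DR_gt1 : 1 < D%:R :> R. Proof. by rewrite ltr1n. Qed.
Let DR_gt0 : 0 < D%:R :> R. Proof. by apply: lt_trans DR_gt1. Qed.

Notation kap := (growth D psi).
Let kap_gt1 : 1 < kap. Proof. exact: growth_gt1. Qed.
Let kap_gt0 : 0 < kap. Proof. exact: lt_trans kap_gt1. Qed.

Variables (m0 C1 : nat).
Hypothesis m0P : decay D psi ^+ m0.+1 <= (4 * (64 * D%:R) ^+ 2)^-1.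
Hypothesis C1P : forall n r, (0 < n)%N ->
  (2 * 32 ^ 2 * D ^ 2 * (trunc_log 2 n).+1 ^ 2 * D ^ (4 * r) <= n)%N
  || ((trunc_log 2 n).+1 <= C1 * r.+1)%N.

Definition cost_const : R := 8 * D%:R * (m0.+2%:R * C1.+2%:R).

(** The expected number of steps spent for each new vertex when [r] is the depth
of the set left to visit. *)
Definition cost (r : nat) : R := cost_const * r.+1%:R * (D%:R / kap) ^+ r.

Let cost_const_ge0 : 0 <= cost_const.
Proof. by rewrite !mulr_ge0 ?ler0n. Qed.

Lemma cost_ge0 r : 0 <= cost r.
Proof.
by rewrite /cost mulr_ge0 ?mulr_ge0 ?exprn_ge0 ?divr_ge0 ?ler0n ?(ltW kap_gt0).
Qed.

Lemma cost_mono r s : (r <= s)%N -> cost r <= cost s.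
Proof.
move=> rs; rewrite /cost ler_pM ?mulr_ge0 ?exprn_ge0 ?divr_ge0 ?ler0n ?(ltW kap_gt0) //.
  by rewrite ler_wpM2l // ler_nat.
by rewrite ler_weXn2l // ler_pdivlMr // mul1r growth_leD.
Qed.

Section OneGraph.
Variables (G : graph) (d : nat).
Hypotheses (reg : forall x : G, degree x = d) (d_gt0 : (0 < d)%N) (dD : (d <= D)%N).
Hypothesis expansion : forall S : {set G}, (0 < #|S|)%N ->
  (2 * #|S| <= #|G|)%N -> psi * #|S|%:R <= #|nbrs S :\: S|%:R.

Notation n := #|G|.

Lemma plan_exists (U : {set G}) x : (0 < #|U|)%N -> x \notin U ->
  exists ks : seq (move G), (0 < size ks)%N /\
    (size ks)%:R <= cost (depth D n #|U|)
                     * (#|U|%:R - run ks (@card_left R G) U x).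
Proof.
move=> U0 xU; set r := depth D n #|U|.
have n0 : (0 < n)%N by apply: leq_trans U0 (max_card _).
have nR0 : 0 < n%:R :> R by rewrite ltr0n.
set L := trunc_log 2 n.
pose rate : R := \sum_y iter r (@boost R G) (@indicator R G U) y / n%:R.
pose B : R := Num.sqrt (2 * 4 ^+ r / n%:R).
have rate_base : (4 * D%:R ^+ r.+1)^-1 <= rate.
  exact: (rate_ge_base D_gt1 psi_gt0 reg d_gt0 dD expansion U0).
have [J [J0 [JB sizeJ]]] : exists J, (0 < J)%N /\ (J.-1%:R * B <= rate / 8 /\
    (m0.+1 * L.+1 + J * (m0.+1 * r.+1 + r) <= m0.+2 * C1.+2 * (J * r.+1))%N).
  have [many|few] := orP (C1P r n0); last first.
    (* A single attempt: no returns have to be controlled. *)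
    exists 1%N; split=> //; split; last first.
      exact: few_blocks_size few (leqnSn r).
    by rewrite mul0r divr_ge0 // (le_trans _ rate_base) // invr_ge0 mulr_ge0 ?exprn_ge0.
  (* As many attempts as it takes to amortize the initial mixing. *)
  exists L.+1; split=> //; split; last first.
    exact: many_blocks_size (ltn0Sn r) (leqnSn r).
  have B0 : 0 <= B by exact: sqrtr_ge0.
  apply: (@le_trans _ _ ((4 * D%:R ^+ r.+1)^-1 / 8)); last first.
    by rewrite ler_wpM2r.
  rewrite /= -ler_sqr ?nnegrE ?mulr_ge0 ?invr_ge0 ?mulr_ge0 ?exprn_ge0 ?(ltW DR_gt0) //.
  rewrite exprMn sqr_sqrtr; last by rewrite divr_ge0 ?mulr_ge0 ?exprn_ge0 ?ler0n.
  rewrite mulrA ler_pdivrMr // -invfM exprVn ler_pdivlMl ?exprn_gt0 ?mulr_gt0 ?exprn_gt0 //.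
  have : ((32 * D ^ r.+1) ^ 2 * (L ^ 2 * (2 * 4 ^ r)) <= n)%N.
    apply: leq_trans many; apply: leq_trans (many_blocks_variance _ _ D_gt1) _.
    by rewrite leq_mul2r leq_mul2l leq_sqr leqnSn !orbT.
  rewrite -(ler_nat R) !(natrM, natrX) => le.
  by apply: le_trans le; rewrite le_eqVlt; apply/orP; left; apply/eqP; ring.
exists (plan R D m0 U J); rewrite size_plan -/r -/L; split; first by nia.
have gain := plan_gain D_gt1 psi_gt0 psi_le1 reg d_gt0 dD expansion m0P U0 xU JB.
have rate0 : (4 * D%:R ^+ r.+1)^-1 * kap ^+ r <= rate.
  by apply: (rate_ge D_gt1 psi_gt0 reg d_gt0 dD expansion U0).
set g := #|U|%:R - _ in gain *.
apply: (@le_trans _ _ ((m0.+2 * C1.+2 * (J * r.+1))%N%:R)); first by rewrite ler_nat.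
have c0 : 0 < (4 * D%:R ^+ r.+1)^-1 * kap ^+ r.
  by rewrite mulr_gt0 ?invr_gt0 ?mulr_gt0 ?exprn_gt0.
have : J%:R * ((4 * D%:R ^+ r.+1)^-1 * kap ^+ r) <= 2 * g.
  apply: le_trans (_ : J%:R * rate <= _); first by rewrite ler_wpM2l.
  by move: gain; rewrite -/rate; lra.
rewrite -ler_pdivlMr // => JE.
rewrite natrM (natrM _ J) mulrCA.
apply: (@le_trans _ _ (2 * g / ((4 * D%:R ^+ r.+1)^-1 * kap ^+ r) *
   ((m0.+2 * C1.+2)%N%:R * r.+1%:R))).
  by rewrite ler_wpM2r // mulr_ge0.
rewrite /cost /cost_const !natrM exprS exprMn exprVn le_eqVlt; apply/orP; left.
apply/eqP; field.
by rewrite !expf_neq0 ?gt_eqF.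
Qed.

(** Twice the sum of the costs: the factor two turns the bound of [plan_exists]
into the strict decrease asked for by [value_le_drift]. *)
Definition potential (w : nat) : R := 2 * \sum_(j < w) cost (depth D n j.+1).

Lemma potential_ge0 w : 0 <= potential w.
Proof. by rewrite mulr_ge0 // sumr_ge0 // => j _; exact: cost_ge0. Qed.

Lemma potential_tangent w j :
  potential j <= potential w.+1 - 2 * cost (depth D n w.+1) * (w.+1%:R - j%:R).
Proof.
have := @sum_tangent R (fun j => cost (depth D n j.+1)) w j
  (fun i k ik => cost_mono (@depth_anti D n i.+1 k.+1 (ltn0Sn i) ik)).
by rewrite /potential; lra.
Qed.

Lemma value_le_potential T (U : {set G}) x : x \notin U ->
  value R T U x <= potential #|U|.
Proof.
apply: (value_le_drift reg d_gt0 potential_ge0) => {}U {}x U0 xU.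
have [ks [ks0 ksE]] := plan_exists U0 xU; exists ks.
case: #|U| U0 ksE (fun j => @potential_tangent #|U|.-1 j) => // w _ ksE tangent.
set a := cost _ in ksE.
have : run ks (fun W _ => potential #|W|) U x <=
    (potential w.+1 - 2 * a * w.+1%:R) + 2 * a * run ks (@card_left R G) U x.
  rewrite -[X in _ <= X + _](run_const reg d_gt0 ks _ U x) -[X in _ <= X + _]mul1r.
  rewrite -(run_lin ks 1 (2 * a)); apply: run_le => // W y yW.
  rewrite mul1r; apply: le_trans (tangent _) _ => /=; rewrite /card_left -/a; lra.
have : 0 < (size ks)%:R :> R by rewrite ltr0n.
move: ksE; lra.
Qed.

(** Sort the terms by depth. At most [n / D ^ r] sizes have depth [r], which
compensates the factor [D ^ r] of the cost. *)
Lemma potential_le : potential n <= 2 * (cost_const * ((1 - kap^-1) ^+ 2)^-1) * n%:R.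
Proof.
rewrite /potential -mulrA ler_pM2l //.
have depth_lt (j : 'I_n) : (depth D n j.+1 < n.+1)%N.
  rewrite ltnS; apply: ltnW; apply: leq_trans (ltn_expl _ D_gt1) _.
  apply: leq_trans (_ : D ^ depth D n j.+1 * j.+1 <= _)%N; first by rewrite leq_pmulr.
  by apply: depth_mul_le => //=; exact: ltn_ord.
have q01 : 0 <= kap^-1 < 1 by rewrite invr_ge0 (ltW kap_gt0) /= invf_lt1.
apply: (@le_trans _ _ (\sum_(r < n.+1) cost r * (n%:R / D%:R ^+ r))).
  rewrite (eq_bigr (fun j : 'I_n =>
      \sum_(r < n.+1) cost r * (depth D n j.+1 == r)%:R)); last first.
    move=> j _; rewrite (bigD1 (Ordinal (depth_lt j))) //= eqxx mulr1 big1 ?addr0 //.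
    move=> r /negPf; rewrite -val_eqE /= eq_sym => ->; by rewrite mulr0.
  rewrite exchange_big /=; apply: ler_sum => r _; rewrite -mulr_sumr.
  rewrite ler_wpM2l ?cost_ge0 // -natr_sum ler_pdivlMr ?exprn_gt0 //.
  rewrite -natrX -natrM ler_nat -leq_divRL ?expn_gt0 ?(ltnW D_gt1) //.
  exact: count_depth_le.
rewrite (eq_bigr (fun r : 'I_n.+1 =>
    (cost_const * n%:R) * (r.+1%:R * kap^-1 ^+ r))); last first.
  move=> r _; rewrite /cost exprMn; field.
  by rewrite !expf_neq0 ?gt_eqF.
rewrite -mulr_sumr mulrAC ler_wpM2r ?ler0n // ler_wpM2l //.
exact: sum_arith_geom.
Qed.

Lemma crw_cover_time_linear : (0 < n)%N ->
  (crw_cover_time R G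
    <= (2 * (2 * (cost_const * ((1 - kap^-1) ^+ 2)^-1) * n%:R))%:E)%E.
Proof.
move=> n0; apply: (crw_cover_time_le reg d_gt0) => T U x xU.
apply: le_trans (value_le_potential T xU) _; apply: le_trans potential_le.
rewrite /potential ler_pM2l // -(subnKC (max_card U)) big_split_ord /= lerDl.
by apply: sumr_ge0 => j _; exact: cost_ge0.
Qed.

End OneGraph.

Lemma cost_const_gt0 : 0 < cost_const.
Proof. by rewrite !mulr_gt0. Qed.

End Total.

(** * Uniform constants for a sequence of expanders *)

Lemma vertex_expansionP (R : realType) (G : graph) (psi : R) :
    (psi%:E <= vertex_expansion R G)%E ->
  forall S : {set G}, (0 < #|S|)%N -> (2 * #|S| <= #|G|)%N ->
    psi * #|S|%:R <= #|nbrs S :\: S|%:R.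
Proof.
move=> le S S0 S2; have SR : 0 < #|S|%:R :> R by rewrite ltr0n.
have GR : 0 < #|G|%:R :> R by rewrite ltr0n; lia.
rewrite -ler_pdivlMr // -lee_fin; apply: le_trans le _.
rewrite /vertex_expansion; apply: bigmin_le_cond.
rewrite divr_gt0 //= ler_pdivrMr // mulrC ler_pdivlMr // -natrM ler_nat.
by rewrite mulnC.
Qed.

Theorem corollary1p5 (R : realType) (G : nat -> graph)
    (Gbounded : exists D : nat, forall (i : nat) (x : G i), (degree x <= D)%N)
    (Gexp : is_expander R G) :
  exists c C : R, [/\ 0 < c, 0 < C &
    \forall i \near \oo%classic,
      (((c * #|G i|%:R)%:E <= crw_cover_time R (G i))%E /\
       (crw_cover_time R (G i) <= (C * #|G i|%:R)%:E)%E)].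
Proof.
have [D' deg_le'] := Gbounded; have [reg [psi' psi'0 exp] nG] := Gexp.
(* With these choices [growth D psi] is at most [D]. *)
pose D := maxn D' 2; pose psi := Num.min psi' 1.
have D_gt1 : (1 < D)%N by rewrite leq_max orbT.
have psi_gt0 : 0 < psi by rewrite lt_min psi'0 ltr01.
have psi_le1 : psi <= 1 by rewrite ge_min lexx orbT.
have [C1 C1P] := regime D_gt1 (2 * 32 ^ 2 * D ^ 2).
(* [m0.+1] lazy steps per step of control offset the factor [4] of control and
   leave a factor that beats the loss of [D] in the density of the target. *)
have [m0 m0P] : exists m0, decay D psi ^+ m0.+1 <= (4 * (64 * D%:R) ^+ 2)^-1.
  have c01 : 0 <= decay D psi < 1.
    by rewrite decay_ge0 // decay_lt1.
  have [|m le] := exprn_small c01 (_ : 0 < (4 * (64 * D%:R) ^+ 2)^-1).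
    by rewrite invr_gt0 !mulr_gt0 // ltr0n ltnW.
  exists m; apply: le_trans le; rewrite exprS ler_piMl ?exprn_ge0 //.
    by case/andP: c01.
  by case/andP: c01 => _ /ltW.
pose C0 := 2 * (2 * (cost_const R D m0 C1 * ((1 - (growth D psi)^-1) ^+ 2)^-1)).
exists 2^-1, C0; split; first by rewrite invr_gt0.
  have k1 := growth_gt1 D_gt1 psi_gt0.
  rewrite !mulr_gt0 ?cost_const_gt0 ?ltr0n ?(ltnW D_gt1) // invr_gt0 exprn_gt0 // subr_gt0.
  by rewrite invf_lt1 // (lt_trans _ k1).
have [N _ hN] : \forall i \near \oo%classic, (2 <= #|G i|)%N.
  exact: (nG _ (nbhs_infty_ge 2)).
exists N => // i Ni; have {hN Ni} n2 : (2 <= #|G i|)%N := hN i Ni.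
have [d regi] := reg i.
have expi := vertex_expansionP (exp i).
have expansion (S : {set G i}) : (0 < #|S|)%N -> (2 * #|S| <= #|G i|)%N ->
    psi * #|S|%:R <= #|nbrs S :\: S|%:R.
  by move=> S0 S2; apply: le_trans (expi S S0 S2); rewrite ler_wpM2r // ge_min lexx.
have /card_gt0P[x _] : (0 < #|G i|)%N by exact: ltnW.
have d_gt0 : (0 < d)%N.
  have : 0 < #|nbrs [set x] :\: [set x]|%:R :> R.
    apply: lt_le_trans (expansion [set x] _ _); rewrite ?cards1 ?muln1 //.
    by rewrite mulr1.
  rewrite ltr0n => /card_gt0P[y]; rewrite !inE => /andP[_ /exists_inP[z]].
  rewrite inE => /eqP -> yx; rewrite -(regi x); apply/card_gt0P; exists y.
  by rewrite inE edge_sym.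
have dD : (d <= D)%N by rewrite -(regi x) leq_max deg_le'.
have n_gt0 : (0 < #|G i|)%N by exact: ltnW.
split.
  apply: le_trans (crw_cover_time_ge R regi d_gt0 n_gt0).
  rewrite lee_fin ler_pdivrMl // -natrM ler_nat; lia.
rewrite -[C0 * _]mulrA.
exact: (crw_cover_time_linear D_gt1 psi_gt0 psi_le1 m0P C1P regi d_gt0 dD expansion n_gt0).
Qed.
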